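(* Let $k \geq 2$ be an integer and let $n := 2^k$. Let $R_k$ be either of the two trigonometric polynomials $R_k(t) := |P_k(e^{it})|^2$ or $R_k(t) := |Q_k(e^{it})|^2$, where $P_k$ and $Q_k$ are the Rudin-Shapiro polynomials. Then for every interval $I := [\alpha,\beta] \subset [0,2\pi)$, with length $|I| := \beta-\alpha$, $$\frac{n|I|}{8\pi} - \frac{2}{\pi}(2n\log n)^{1/2} - 1 \leq {\mathcal N}(I,R_k-n) \leq \frac{n|I|}{\pi} + \frac{8}{\pi}(2n\log n)^{1/2}\,.$$
   Context: The Rudin-Shapiro polynomials are defined recursively by $P_0(z) := 1$, $Q_0(z) := 1$, and $$P_{k+1}(z) := P_k(z) + z^{2^k}Q_k(z)\,, \qquad Q_{k+1}(z) := P_k(z) - z^{2^k}Q_k(z)\,, \qquad k=0,1,2,\ldots\,.$$ Thus $P_k$ and $Q_k$ are polynomials of degree $n-1$ with $n=2^k$ and all coefficients in $\{-1,1\}$. For an interval $I := [\alpha,\beta] \subset [0,2\pi)$, ${\mathcal N}(I,R_k-n)$ denotes the number of zeros, counted with multiplicities, of the trigonometric polynomial $t \mapsto R_k(t)-n$ in $I$. *)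

(* Defs.v *)
From mathcomp Require Import all_boot all_order all_algebra.
From mathcomp Require Import all_classical all_reals all_analysis.
From mathcomp Require Import complex.

Set Implicit Arguments.
Unset Strict Implicit.
Unset Printing Implicit Defensive.

Import Order.TTheory GRing.Theory Num.Theory.
Import numFieldNormedType.Exports.

Local Open Scope classical_set_scope.
Local Open Scope ring_scope.
Local Open Scope complex_scope.

Section RudinShapiro.
Variable R : realType.

(* The pair (P_k, Q_k). *)
Fixpoint rudin_shapiro (k : nat) : {poly R[i]} * {poly R[i]} :=
  if k is k'.+1 then
    let: (P, Q) := rudin_shapiro k' in
    (P + 'X^(2 ^ k') * Q, P - 'X^(2 ^ k') * Q)
  else (1, 1).

Definition RSP (k : nat) : {poly R[i]} := (rudin_shapiro k).1.
Definition RSQ (k : nat) : {poly R[i]} := (rudin_shapiro k).2.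

Definition expi (t : R) : R[i] := cos t +i* sin t.

Definition sqmod_circle (p : {poly R[i]}) (t : R) : R :=
  ComplexField.Normc.normc p.[expi t] ^+ 2.

End RudinShapiro.

Section ZeroCounting.
Variable R : realType.

(* The order of vanishing of a smooth function f at t: the least m such that
   the m-th derivative of f does not vanish at t, and +oo if there is none.
   In particular it is 0 when f t != 0. *)
Definition zero_mult (f : R -> R) (t : R) : \bar R :=
  ereal_inf [set m%:R%:E | m in [set m : nat | derive1n m f t != 0]].

(* A point t where f t != 0 contributes 0, so summing over all of I counts the
   zeros of f in I with multiplicity; the count is +oo if it is not finite. *)
Definition zero_count (I : set R) (f : R -> R) : \bar R :=
  (\esum_(t in I) zero_mult f t)%R.

End ZeroCounting.

(* Main.v *)
Require Import Defs.
From mathcomp Require Import all_boot all_order all_algebra finmap.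
From mathcomp Require Import all_classical all_reals all_analysis.
From mathcomp Require Import complex ring lra.

Set Implicit Arguments.
Unset Strict Implicit.
Unset Printing Implicit Defensive.

Import Order.TTheory GRing.Theory Num.Theory.
Import numFieldNormedType.Exports.

Local Open Scope classical_set_scope.
Local Open Scope ring_scope.

(** Why the theorem is true.

    Put n = 2^k and f(t) = R_k(t) - n.  Since |P_k|^2 + |Q_k|^2 = 2n on the
    unit circle, |f| <= n; and f(t) = z^(1-n) p(z) at z = e^(it), where p is a
    polynomial of degree 2n - 2 whose first and last coefficients have
    modulus 1.

    Upper bound.  This is an inequality of Erdos-Turan type
    ([poly_arc_mult_le]): if p has degree N, if the product of the moduli of
    its extreme coefficients is at least 1 and if |p| <= M on the circle, then,
    for every 0 < d < 1, an arc I carries at most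
    N |I| / (2 pi) + N d + 16 ln M / (pi^2 d) zeros of p, with multiplicity.
    Moving the zeros radially onto the circle only makes the normalised |p|
    smaller there, so p may be replaced by the product of the z - e^(i x_k).
    By the maximum principle u = ln M - ln |p| is then a nonnegative harmonic
    function in the disc, u(0) = ln M, and its Fourier coefficients are half
    the power sums of the zeros divided by the frequency.  Hence testing u against
    a nonnegative trigonometric polynomial g gives a linear inequality between
    these power sums and the mean of g ([log_mean_pos]).  The number of x_k in
    [a, b] is N (b - a) / (2 pi) plus a sum of sawtooth values at x_k - a and at
    b - x_k, so one needs a majorant of the sawtooth which is cheap in both
    respects: small mean, and small maximum after multiplying its j-th Fourier
    coefficient by j.
    [saw_major], built from the Poisson kernel of radius r, is such a majorant
    ([saw_major_ge]); with d = (1 - r) / (1 + r) its mean is d / 2 and its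
    weighted series is at most 4 / (pi^2 d) ([saw_major_freq_le]), which gives
    [sawtooth_sum_le].  For N rounded up to 2n and M = n the best d is
    (4 / pi) (ln n / 2n)^(1/2).  Finally the order of vanishing of f at t is at
    most the multiplicity of e^(it) as a root of p ([zero_mult_le]).

    Lower bound.  Unfolding the recursion twice at an n-th root of unity shows
    that at t_j = 2 pi j / n, up to a global sign, R_k - n takes the value
    (-1)^j 4 (R_(k-2) - n/4), where R_(k-2) = |P_(k-2)|^2 ([excess_nodes]).  By
    the intermediate value theorem each interval [t_j, t_(j+1)] contains a zero
    of R_k - n, unless its interior contains a zero of R_(k-2) - n/4.  There are
    at least n |I| / (2 pi) - 2 such intervals in I, the upper bound for k - 2
    limits the exceptional ones to about half of them, and a zero of R_k - n
    lies in at most two of the others ([zero_count_lower_alternating]). *)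

Local Notation normc := ComplexField.Normc.normc.

(** * Trigonometric sums and the logarithmic kernel *)

Section TrigSums.
Variable R : realType.
Implicit Types (s t x c r : R) (n m j : nat).

Lemma cosD2npi n x : cos (x + n%:R * (2 * pi)) = cos x.
Proof.
have -> : x + n%:R * (2 * pi) = x + (pi *+ 2) *+ n.
  by rewrite -(mulr_natl (pi *+ 2)) -(mulr_natl pi).
exact: (periodicn (@cosD2pi R)).
Qed.

Lemma sinD2npi n x : sin (x + n%:R * (2 * pi)) = sin x.
Proof. by rewrite -!cosBpihalf addrAC cosD2npi. Qed.

(** Multiplied by 2 sin (h/2), h = 2 pi q / N, the sum telescopes to a
    difference of sines over a whole number of periods. *)
Lemma node_sum_cos N q c : (0 < q < N)%N ->
  \sum_(l < N) cos (q%:R * (l%:R * (2 * pi / N%:R)) + c) = 0.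
Proof.
move=> /andP[q0 qN].
have Np : 0 < N%:R :> R by rewrite ltr0n (ltn_trans q0).
have N0 : N%:R != 0 :> R by rewrite gt_eqF.
pose h : R := q%:R * (2 * pi / N%:R).
have h2 : 0 < sin (h / 2).
  apply: sin_gt0_pi; rewrite /h.
  have -> : q%:R * (2 * pi / N%:R) / 2 = pi * (q%:R / N%:R) :> R by field.
  have qp : 0 < q%:R :> R by rewrite ltr0n.
  rewrite mulr_gt0 ?pi_gt0 ?divr_gt0//=.
  by rewrite gtr_pMr ?pi_gt0// ltr_pdivrMr// mul1r ltr_nat.
have key M : 2 * sin (h / 2) * \sum_(l < M) cos (q%:R * (l%:R * (2 * pi / N%:R)) + c)
   = sin (c - h / 2 + M%:R * h) - sin (c - h / 2).
  elim: M => [|M IH]; first by rewrite big_ord0 mulr0 mul0r addr0 subrr.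
  rewrite big_ord_recr /= mulrDr IH.
  have -> : c - h / 2 + M.+1%:R * h = (c + M%:R * h) + h / 2.
    by rewrite -natr1; field.
  have -> : c - h / 2 + M%:R * h = (c + M%:R * h) - h / 2 by ring.
  have -> : q%:R * (M%:R * (2 * pi / N%:R)) + c = c + M%:R * h by rewrite /h; ring.
  by move: (c + M%:R * h) => u; rewrite (sinB u) (sinD u); ring.
have /eqP : 2 * sin (h / 2) * \sum_(l < N) cos (q%:R * (l%:R * (2 * pi / N%:R)) + c) = 0.
  rewrite key.
  have -> : N%:R * h = q%:R * (2 * pi) by rewrite /h; field.
  by rewrite sinD2npi subrr.
by rewrite mulf_eq0 mulf_eq0 pnatr_eq0 /= (gt_eqF h2) => /eqP.
Qed.

Lemma node_sum_cos_cos N j m phi x : (0 < j)%N -> (0 < m)%N -> (j + m < N)%N ->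
  \sum_(l < N) cos (j%:R * (l%:R * (2 * pi / N%:R)) - phi) *
               cos (m%:R * (l%:R * (2 * pi / N%:R) - x)) =
  if j == m then N%:R / 2 * cos (m%:R * x - phi) else 0.
Proof.
move=> j0 m0 jmN.
pose tl (l : 'I_N) : R := l%:R * (2 * pi / N%:R).
rewrite (eq_bigr (fun l : 'I_N =>
   2^-1 * cos ((j + m)%:R * tl l + (- phi - m%:R * x)) +
   2^-1 * cos (j%:R * tl l - m%:R * tl l + (m%:R * x - phi)))); last first.
  move=> l _; rewrite -/(tl l).
  have -> : (j + m)%:R * tl l + (- phi - m%:R * x)
    = (j%:R * tl l - phi) + m%:R * (tl l - x) by rewrite natrD; ring.
  have -> : j%:R * tl l - m%:R * tl l + (m%:R * x - phi)
    = (j%:R * tl l - phi) - m%:R * (tl l - x) by ring.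
  move: (_ * tl l - phi) (_ * (tl l - x)) => u v.
  by rewrite (cosB u) (cosD u); field.
rewrite big_split /= -!mulr_sumr node_sum_cos; last by rewrite addn_gt0 j0.
rewrite mulr0 add0r.
have [jm|jm|jm] := ltngtP j m.
- rewrite (eq_bigr (fun l : 'I_N => cos ((m - j)%:R * tl l + (phi - m%:R * x)))).
    rewrite node_sum_cos ?mulr0// subn_gt0 jm (leq_ltn_trans (leq_subr _ _))//.
    by rewrite (leq_ltn_trans _ jmN)// leq_addl.
  by move=> l _; rewrite -cosN; congr cos; rewrite natrB 1?ltnW//; ring.
- rewrite (eq_bigr (fun l : 'I_N => cos ((j - m)%:R * tl l + (m%:R * x - phi)))).
    rewrite node_sum_cos ?mulr0// subn_gt0 jm (leq_ltn_trans (leq_subr _ _))//.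
    by rewrite (leq_ltn_trans _ jmN)// leq_addr.
  by move=> l _; congr cos; rewrite natrB 1?ltnW//; ring.
- rewrite (eq_bigr (fun l : 'I_N => cos (m%:R * x - phi))); last first.
    by move=> l _; rewrite jm subrr add0r.
  by rewrite sumr_const card_ord -mulr_natl; ring.
Qed.

(** The square of the modulus of 1 - r e^(is). *)
Definition Delta r s : R := 1 - 2 * r * cos s + r ^+ 2.

Lemma Delta_ge r s : 0 <= r -> (1 - r) ^+ 2 <= Delta r s.
Proof. by move=> r0; have := cos_le1 s; rewrite /Delta; nra. Qed.

Lemma Delta_gt0 r s : 0 <= r < 1 -> 0 < Delta r s.
Proof.
move=> /andP[r0 r1]; apply: lt_le_trans (Delta_ge s r0).
by rewrite exprn_gt0 ?subr_gt0.
Qed.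

Lemma geom_cos_sum K r s :
  Delta r s * \sum_(1 <= m < K.+1) r ^+ m.-1 * cos (m%:R * s) =
  cos s - r - r ^+ K * cos (K.+1%:R * s) + r ^+ K.+1 * cos (K%:R * s).
Proof.
elim: K => [|K IH].
  by rewrite big_geq// mulr0 !expr0 expr1 !mul1r !mul0r cos0; ring.
rewrite big_nat_recr //= mulrDr IH /Delta.
have E1 : K.+1%:R * s = K%:R * s + s by rewrite -natr1; ring.
have E2 : K.+2%:R * s = K%:R * s + s + s by rewrite -2!natr1; ring.
rewrite E2 E1 !exprS; set a := K%:R * s; have := cos2Dsin2 s.
rewrite (cosD (a + s)) (sinD a) (cosD a).
set ca := cos a; set sa := sin a; set c := cos s; set z := sin s => cz.
have -> : z ^+ 2 = 1 - c ^+ 2 ->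
  (ca * c - sa * z) * c - (sa * c + ca * z) * z = 2 * c * (ca * c - sa * z) - ca.
  by move=> zz; transitivity (ca * c ^+ 2 - 2 * sa * z * c - ca * z ^+ 2); [ring|rewrite zz; ring].
- ring.
- by rewrite -cz; ring.
Qed.

Lemma is_derive_bigsum (F : nat -> R -> R) (dF : nat -> R) a b x :
  (forall m, (a <= m < b)%N -> is_derive x (1 : R) (F m) (dF m)) ->
  is_derive x (1 : R) (fun y => \sum_(a <= m < b) F m y) (\sum_(a <= m < b) dF m).
Proof.
have [ab|ba] := leqP a b; last first.
  move=> _; rewrite big_geq 1?ltnW//; under eq_fun do rewrite big_geq 1?ltnW//.
  exact: is_derive_cst.
rewrite -(subnKC ab); elim: (b - a)%N => [|k IH] H.
  rewrite addn0 big_geq//; under eq_fun do rewrite big_geq//.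
  exact: is_derive_cst.
rewrite addnS big_nat_recr ?leq_addr//=.
under eq_fun do rewrite big_nat_recr ?leq_addr//=.
apply: is_deriveD.
  by apply: IH => m /andP[am mk]; apply: H; rewrite am addnS ltnS ltnW.
by apply: H; rewrite leq_addr addnS leqnn.
Qed.

Lemma is_derive_exprn m x :
  is_derive x (1 : R) (fun y => y ^+ m) (m%:R * x ^+ m.-1).
Proof.
have -> : (fun y : R => y ^+ m) = id ^+ m by rewrite exprfctE.
by apply: (is_derive_eq (is_deriveX m (is_derive_id x 1))); rewrite /GRing.scale /= mulr1.
Qed.

(** The Taylor expansion in r of ln |1 - r e^(is)|^2.  The two sides agree at
    r = 0 and the difference of their r-derivatives is the tail of a geometric
    sum, so the mean value theorem gives an error bound that is uniform in s. *)
Lemma ln_Delta_series K r s : 0 <= r < 1 ->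
  `|ln (Delta r s) + 2 * \sum_(1 <= m < K.+1) r ^+ m / m%:R * cos (m%:R * s)|
  <= 4 / (1 - r) ^+ 2 * r ^+ K.
Proof.
move=> /andP[r0 r1].
pose F (y : R) := ln (Delta y s) + 2 * \sum_(1 <= m < K.+1) y ^+ m / m%:R * cos (m%:R * s).
pose dF (y : R) := (- 2 * cos s + 2 * y) / Delta y s +
   2 * \sum_(1 <= m < K.+1) y ^+ m.-1 * cos (m%:R * s).
have dDelta (y : R) : is_derive y (1 : R) (fun z : R => Delta z s) (- 2 * cos s + 2 * y).
  by rewrite /Delta; apply: is_derive_eq; rewrite /GRing.scale /=; ring.
have dFE (y : R) : 0 <= y < 1 -> is_derive y (1 : R) F (dF y).
  move=> y01; have D0 := Delta_gt0 s y01.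
  have d1 : is_derive y (1 : R) (fun y : R => ln (Delta y s)) ((- 2 * cos s + 2 * y) / Delta y s).
    have := @is_derive1_comp _ (@ln R) (fun z : R => Delta z s) y _ _ (is_derive1_ln D0) (dDelta y).
    by rewrite mulrC.
  have d2 : is_derive y (1 : R) (fun y : R => \sum_(1 <= m < K.+1) y ^+ m / m%:R * cos (m%:R * s))
     (\sum_(1 <= m < K.+1) y ^+ m.-1 * cos (m%:R * s)).
    apply: (@is_derive_bigsum (fun m y => y ^+ m / m%:R * cos (m%:R * s))) => -[//|m] _.
    have d0 : m.+1%:R != 0 :> R by rewrite pnatr_eq0.
    have -> : (fun y : R => y ^+ m.+1 / m.+1%:R * cos (m.+1%:R * s)) =
       (cos (m.+1%:R * s) / m.+1%:R) \*: (fun y : R => y ^+ m.+1).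
      by apply/funext => z; rewrite /GRing.scale /= mulrC mulrA mulrAC.
    apply: (is_derive_eq (is_deriveZ _ (is_derive_exprn m.+1 y))).
    rewrite /GRing.scale /=.
    by move: (m.+1%:R) d0 => d d0; field.
  by apply: is_deriveD; apply: is_deriveZ.
have bF (c : R) : 0 <= c <= r -> `|dF c| <= 4 / (1 - r) ^+ 2 * r ^+ K.
  move=> /andP[c0 cr].
  have c1 : c < 1 by apply: le_lt_trans r1.
  have D0 : 0 < Delta c s by apply: Delta_gt0; rewrite c0.
  have -> : dF c = 2 * (c ^+ K.+1 * cos (K%:R * s) - c ^+ K * cos (K.+1%:R * s)) / Delta c s.
    rewrite /dF; have := geom_cos_sum K c s.
    set S := \sum_(_ <= _ < _) _ => E.
    apply: (mulIf (lt0r_neq0 D0)); rewrite mulrDl !divfK ?gt_eqF//.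
    by rewrite -mulrA (mulrC S) E; ring.
  rewrite normrM normfV (gtr0_norm D0).
  rewrite ler_pdivrMr//.
  have h1 : `|2 * (c ^+ K.+1 * cos (K%:R * s) - c ^+ K * cos (K.+1%:R * s))| <= 4 * r ^+ K.
    rewrite normrM ger0_norm//.
    have -> : 4 * r ^+ K = 2 * (r ^+ K + r ^+ K) by ring.
    rewrite ler_pM2l//; apply: (le_trans (ler_normB _ _)); rewrite !normrM.
    have cK : c ^+ K <= r ^+ K by rewrite lerXn2r// nnegrE (le_trans c0 cr).
    have cK1 : c ^+ K.+1 <= r ^+ K.
      by rewrite exprS (le_trans _ cK)// ler_piMl ?exprn_ge0// ltW.
    apply: lerD.
      rewrite ger0_norm ?exprn_ge0// (le_trans _ cK1)// ler_piMr ?exprn_ge0//.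
      exact: cos_max.
    rewrite ger0_norm ?exprn_ge0// (le_trans _ cK)// ler_piMr ?exprn_ge0//.
    exact: cos_max.
  apply: (le_trans h1).
  have -> : 4 / (1 - r) ^+ 2 * r ^+ K * Delta c s = 4 * r ^+ K * (Delta c s / (1 - r) ^+ 2) by ring.
  rewrite ler_peMr ?mulr_ge0 ?exprn_ge0// ?(le_trans c0 cr)//.
  rewrite ler_pdivlMr ?mul1r ?exprn_gt0 ?subr_gt0//.
  apply: le_trans (Delta_ge s c0).
  by rewrite lerXn2r ?nnegrE ?subr_ge0 ?(ltW r1) ?(ltW c1)// lerD2l lerN2.
have F0 : F 0 = 0.
  rewrite /F /Delta mulr0 mul0r subr0 expr0n /= addr0 ln1 add0r.
  by rewrite big_nat_cond big1 ?mulr0// => -[//|m] _; rewrite expr0n /= !mul0r.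
have [] := @MVT_segment R F dF 0 r r0.
- by move=> x; rewrite in_itv /= => /andP[x0 xr]; apply: dFE; rewrite (ltW x0) (lt_trans xr).
- apply: derivable_within_continuous => x; rewrite in_itv /= => /andP[x0 xr].
  by apply: ex_derive; apply: dFE; rewrite x0 (le_lt_trans xr).
move=> c crange; rewrite F0 !subr0 => E.
rewrite -/(F r) E normrM (ger0_norm r0).
move: crange; rewrite in_itv /= => /bF cb.
by rewrite (le_trans _ cb)// ler_piMr// ltW.
Qed.
End TrigSums.

(** * Averages of a logarithmic potential over equally spaced nodes *)

Section Positivity.
Variable R : realType.
Implicit Types (s t x c r : R) (n m j : nat).

Definition trig_poly J (g0 : R) (a b : nat -> R) t : R :=
  g0 + \sum_(1 <= j < J.+1) (a j * cos (j%:R * t) + b j * sin (j%:R * t)).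

Definition node N (l : nat) : R := l%:R * (2 * pi / N%:R).

Lemma node_sum_trig_poly N J g0 a b : (J < N)%N ->
  \sum_(l < N) trig_poly J g0 a b (node N l) = N%:R * g0.
Proof.
move=> JN; rewrite /trig_poly big_split /= sumr_const card_ord -(mulr_natl g0).
rewrite exchange_big /= big_nat_cond big1 ?addr0// => j /andP[/andP[j0 jJ] _].
have jN : (0 < j < N)%N by rewrite j0 (leq_trans jJ).
rewrite big_split /= -!mulr_sumr.
have := node_sum_cos (0 : R) jN; under eq_bigr do rewrite addr0; move=> ->.
have := node_sum_cos (- (pi / 2) : R) jN; under eq_bigr do rewrite cosBpihalf.
by move=> ->; rewrite !mulr0 addr0.
Qed.

Lemma node_sum_trig_poly_cos N J g0 a b m x : (0 < m)%N -> (J + m < N)%N ->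
  \sum_(l < N) trig_poly J g0 a b (node N l) * cos (m%:R * (node N l - x)) =
  if (m <= J)%N then N%:R / 2 * (a m * cos (m%:R * x) + b m * sin (m%:R * x)) else 0.
Proof.
move=> m0 JmN.
have mN : (0 < m < N)%N by rewrite m0 (leq_ltn_trans _ JmN)// leq_addl.
under eq_bigr do rewrite /trig_poly mulrDl mulr_suml.
rewrite big_split /= -mulr_sumr.
have c0 : \sum_(l < N) cos (m%:R * (node N l - x)) = 0.
  rewrite -[RHS](node_sum_cos (- (m%:R * x)) mN).
  by apply: eq_bigr => l _; rewrite mulrBr.
rewrite c0 mulr0 add0r exchange_big /=.
rewrite (eq_big_nat _ _ (F2 := fun j => if j == m then
   N%:R / 2 * (a j * cos (j%:R * x) + b j * sin (j%:R * x)) else 0)); last first.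
  move=> j /andP[j0 jJ].
  have jmN : (j + m < N)%N by rewrite (leq_ltn_trans _ JmN)// leq_add2r.
  under eq_bigr do rewrite mulrDl -!mulrA.
  rewrite big_split /= -!mulr_sumr.
  have := node_sum_cos_cos (0 : R) x j0 m0 jmN; under eq_bigr do rewrite subr0.
  rewrite -/(node N _) => ->.
  have := node_sum_cos_cos (pi / 2 : R) x j0 m0 jmN.
  under eq_bigr do rewrite cosBpihalf.
  rewrite -/(node N _) => ->; rewrite subr0 cosBpihalf.
  by case: eqP => [->|_]; ring.
rewrite -big_mkcond /= big_nat1_eq ltnS m0 /=; by case: ifP.
Qed.

Lemma small_expr r C e : 0 <= r < 1 -> 0 < e ->
  exists K0, forall K, (K0 <= K)%N -> C * r ^+ K <= e.
Proof.
move=> /andP[r0 r1] e0.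
have r1' : `|r| < 1 by rewrite ger0_norm.
have /cvgrPdist_le/(_ e e0)[K0 _ H] := cvg_geometric C r1'.
exists K0 => K /H /=; rewrite sub0r normrN /geometric /= => h.
by apply: le_trans h; exact: ler_norm.
Qed.

(** For r < 1 the left-hand side is the mean over a period of g times the sum of
    the ln (Delta r (t - x)), because the j-th Fourier coefficient of
    ln (Delta r) is -1/j times r^j; and the mean of g (Lc - sum) is nonnegative.
    The mean is taken over N equally spaced nodes, which integrates exactly
    products of trigonometric polynomials of total degree less than N. *)
Lemma log_mean_pos_lt1 (th : seq R) J g0 a b r Lc :
  0 <= r < 1 ->
  (forall t, \sum_(x <- th) ln (Delta r (t - x)) <= Lc) ->
  (forall t, 0 <= trig_poly J g0 a b t) ->
  - (\sum_(x <- th) \sum_(1 <= j < J.+1)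
       r ^+ j / j%:R * (a j * cos (j%:R * x) + b j * sin (j%:R * x))) <= Lc * g0.
Proof.
move=> r01 HL Hg; apply/ler_addgt0Pr => e e0.
pose G := `|g0| + \sum_(1 <= j < J.+1) (`|a j| + `|b j|).
have G0 : 0 <= G by rewrite addr_ge0// sumr_ge0// => j _; rewrite addr_ge0.
have gG t : trig_poly J g0 a b t <= G.
  apply: lerD; first exact: ler_norm.
  apply: ler_sum => j _; apply: lerD.
    by rewrite (le_trans (ler_norm _))// normrM ler_piMr// cos_max.
  by rewrite (le_trans (ler_norm _))// normrM ler_piMr// sin_max.
pose C := 4 / (1 - r) ^+ 2.
have [K0 HK0] := small_expr ((size th)%:R * (G * C)) r01 e0.
(* the logarithms are expanded to order K; N exceeds the degree of g times
   the expansion *)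
pose K := (maxn K0 J)%N; pose N := (J + K).+1.
have JK : (J <= K)%N by rewrite leq_maxr.
have Np : 0 < N%:R :> R by rewrite ltr0n.
have eK := HK0 K (leq_maxl _ _).
pose S x := \sum_(1 <= j < J.+1)
       r ^+ j / j%:R * (a j * cos (j%:R * x) + b j * sin (j%:R * x)).
have one x : - (N%:R * S x) - N%:R * (G * C * r ^+ K) <=
   \sum_(l < N) trig_poly J g0 a b (node N l) * ln (Delta r (node N l - x)).
  have -> : - (N%:R * S x) = \sum_(l < N) trig_poly J g0 a b (node N l) *
     (- 2 * \sum_(1 <= m < K.+1) r ^+ m / m%:R * cos (m%:R * (node N l - x))).
    under eq_bigr do rewrite mulrCA mulr_sumr mulr_sumr.
    rewrite exchange_big /=.
    rewrite (eq_big_nat _ _ (F2 := fun m => if (m <= J)%N then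
       - (N%:R * (r ^+ m / m%:R * (a m * cos (m%:R * x) + b m * sin (m%:R * x)))) else 0)).
      rewrite (@big_cat_nat _ _ _ J.+1)//=.
      rewrite [X in _ = _ + X]big_nat_cond [X in _ = _ + X]big1 ?addr0; last first.
        by move=> m /andP[/andP[Jm _] _]; rewrite leqNgt Jm.
      rewrite /S mulr_sumr -sumrN; apply: eq_big_nat => m /andP[_ mJ].
      by rewrite -ltnS mJ.
    move=> m /andP[m0 mK].
    under eq_bigr do rewrite (mulrCA (trig_poly _ _ _ _ _)).
    rewrite -!mulr_sumr node_sum_trig_poly_cos//; last first.
      by rewrite /N ltnS leq_add2l -ltnS.
    by case: ifP => _; [field; rewrite pnatr_eq0 -lt0n | rewrite !mulr0].
  have -> : N%:R * (G * C * r ^+ K) = \sum_(l < N) (G * C * r ^+ K).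
    by rewrite sumr_const card_ord mulr_natl.
  rewrite -sumrB; apply: ler_sum => l _.
  have := ln_Delta_series K (node N l - x) r01; rewrite -/C.
  set h := ln _; set T := \sum_(_ <= _ < _) _ => hT.
  have : - (C * r ^+ K) <= h + 2 * T by apply: lerNnormlW.
  have CK : 0 <= C * r ^+ K.
    by apply: le_trans hT.
  move: (Hg (node N l)) (gG (node N l)); move: (trig_poly _ _ _ _ _) => g g0' gG' H.
  nra.
have P : 0 <= \sum_(l < N) trig_poly J g0 a b (node N l) *
   (Lc - \sum_(x <- th) ln (Delta r (node N l - x))).
  by apply: sumr_ge0 => l _; rewrite mulr_ge0// subr_ge0.
have E : \sum_(l < N) trig_poly J g0 a b (node N l) *
   (Lc - \sum_(x <- th) ln (Delta r (node N l - x))) =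
   N%:R * g0 * Lc - \sum_(x <- th) \sum_(l < N)
     trig_poly J g0 a b (node N l) * ln (Delta r (node N l - x)).
  under eq_bigr do rewrite mulrBr mulr_sumr.
  rewrite sumrB -mulr_suml node_sum_trig_poly; last by rewrite /N ltnS leq_addr.
  by congr (_ - _); rewrite exchange_big.
have B : \sum_(x <- th) (- (N%:R * S x) - N%:R * (G * C * r ^+ K)) <=
   \sum_(x <- th) \sum_(l < N) trig_poly J g0 a b (node N l) * ln (Delta r (node N l - x)).
  by apply: ler_sum.
rewrite big_split /= sumrN -mulr_sumr big_const_seq count_predT iter_addr_0 in B.
rewrite E in P; rewrite -/(S _).
rewrite -(ler_pM2l Np).
have -> : \sum_(i <- th) \sum_(1 <= j < J.+1)
   r ^+ j / j%:R * (a j * cos (j%:R * i) + b j * sin (j%:R * i)) = \sum_(i <- th) S i by [].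
move: B P eK; rewrite -mulr_natl.
move: (\sum_(i <- th) S i) (\sum_(x <- th) _) => S1 S2 B P eK.
have : N%:R * ((size th)%:R * (G * C) * r ^+ K) <= N%:R * e by rewrite ler_pM2l.
nra.
Qed.
End Positivity.

(** * Positivity up to the boundary, and geometric sums *)

Section TestFunction.
Variable R : realType.
Implicit Types (s t x c r : R) (n m j : nat).

Lemma bernoulli_sub r j : 0 <= r <= 1 -> 1 - r ^+ j <= j%:R * (1 - r).
Proof.
move=> /andP[r0 r1]; elim: j => [|j IH]; first by rewrite expr0 subrr mul0r.
have := exprn_ile1 j r0 r1; have := exprn_ge0 j r0.
by rewrite exprS -natr1; nra.
Qed.

(** The limit r -> 1 of [log_mean_pos_lt1]: its left-hand side is a polynomial
    in r, and 1 - r^j <= j (1 - r) controls the error explicitly. *)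
Lemma log_mean_pos (th : seq R) J g0 (a b : nat -> R) Lc :
  (forall r t, 0 <= r < 1 -> \sum_(x <- th) ln (Delta r (t - x)) <= Lc) ->
  (forall t, 0 <= trig_poly J g0 a b t) ->
  - (\sum_(x <- th) \sum_(1 <= j < J.+1)
       j%:R^-1 * (a j * cos (j%:R * x) + b j * sin (j%:R * x))) <= Lc * g0.
Proof.
move=> HL Hg; apply/ler_addgt0Pr => e e0.
rewrite exchange_big /=.
pose f j := \sum_(x <- th) j%:R^-1 * (a j * cos (j%:R * x) + b j * sin (j%:R * x)).
rewrite -/(f _).
pose D := \sum_(1 <= j < J.+1) j%:R * `|f j|.
have D0 : 0 <= D by apply: sumr_ge0 => j _; rewrite mulr_ge0.
pose r := 1 - Num.min 1 (e / (1 + D)).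
have h0 : 0 < Num.min 1 (e / (1 + D)) by rewrite lt_min ltr01 divr_gt0// ltr_pwDl.
have h1 : Num.min 1 (e / (1 + D)) <= 1 by rewrite ge_min lexx.
have r01 : 0 <= r < 1 by rewrite /r subr_ge0 h1 gtrBl.
have rD : (1 - r) * D <= e.
  have -> : 1 - r = Num.min 1 (e / (1 + D)) by rewrite /r; ring.
  apply: (@le_trans _ _ (e / (1 + D) * D)).
    by rewrite ler_wpM2r// ge_min lexx orbT.
  rewrite mulrAC ler_pdivrMr ?ltr_pwDl// ler_wpM2l ?ltW//.
  by rewrite ltrDr.
have := log_mean_pos_lt1 r01 (fun t => HL r t r01) Hg.
rewrite exchange_big /=.
have -> : \sum_(1 <= j < J.+1) \sum_(x <- th)
   r ^+ j / j%:R * (a j * cos (j%:R * x) + b j * sin (j%:R * x)) =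
   \sum_(1 <= j < J.+1) r ^+ j * f j.
  by apply: eq_bigr => j _; rewrite mulr_sumr; apply: eq_bigr => x _; rewrite mulrA.
have : \sum_(1 <= j < J.+1) r ^+ j * f j - \sum_(1 <= j < J.+1) f j <= e.
  apply: le_trans rD; rewrite -sumrB /D mulr_sumr; apply: ler_sum => j _.
  have /andP[rr0 rr1] := r01.
  have rle : 0 <= r <= 1 by rewrite rr0 ltW.
  have := bernoulli_sub j rle.
  have := exprn_ile1 j rr0 (ltW rr1).
  have := ler_norm (- f j); rewrite normrN.
  have := ler_norm (f j); have := normr_ge0 (f j).
  nra.
by rewrite -/(f _); lra.
Qed.

(** Both y_j = r^j cos (j s) and y_j = r^j sin (j s) satisfy this recurrence with
    c = cos s, and their characteristic polynomial at 1 is Delta r s. *)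
Lemma geom_rec_sum (y : nat -> R) c r J :
  (forall j, y j.+2 = 2 * r * c * y j.+1 - r ^+ 2 * y j) ->
  (1 - 2 * r * c + r ^+ 2) * \sum_(1 <= j < J.+1) y j =
  y 1%N - r ^+ 2 * y 0%N - y J.+1 + r ^+ 2 * y J.
Proof.
move=> Hy; elim: J => [|J IH]; first by rewrite big_geq// mulr0; ring.
by rewrite big_nat_recr //= mulrDr IH Hy; ring.
Qed.

Lemma geom_rec_wsum (y : nat -> R) c r J :
  (forall j, y j.+2 = 2 * r * c * y j.+1 - r ^+ 2 * y j) ->
  (1 - 2 * r * c + r ^+ 2) * \sum_(1 <= j < J.+1) j%:R * y j =
  (1 - r ^+ 2) * \sum_(1 <= j < J.+1) y j
   - r ^+ 2 * y 0%N + r ^+ 2 * y J - J%:R * y J.+1 + r ^+ 2 * J%:R * y J.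
Proof.
move=> Hy; elim: J => [|J IH]; first by rewrite !big_geq// !mulr0; ring.
rewrite [in LHS]big_nat_recr //= [X in (1 - _) * X]big_nat_recr //=.
by rewrite !mulrDr IH Hy -natr1; ring.
Qed.

(** Y0 and Y1 are the sums of the full series of the y_j and of the j y_j; the
    error eJ does not depend on s, as needed to keep test polynomials
    nonnegative after truncation. *)
Lemma geom_sums_approx (y : nat -> R) s r J : 0 <= r < 1 ->
  (forall j, y j.+2 = 2 * r * cos s * y j.+1 - r ^+ 2 * y j) ->
  (forall j, `|y j| <= r ^+ j) ->
  let Y0 := (y 1%N - r ^+ 2 * y 0%N) / Delta r s in
  let Y1 := ((1 - r ^+ 2) * Y0 - r ^+ 2 * y 0%N) / Delta r s in
  let eJ := 4 / (1 - r) ^+ 4 * (J.+1%:R * r ^+ J) in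
  `|\sum_(1 <= j < J.+1) y j - Y0| <= eJ /\
  `|\sum_(1 <= j < J.+1) j%:R * y j - Y1| <= eJ.
Proof.
move=> r01 Hy yb Y0 Y1 eJ; have /andP[r0 r1] := r01.
have D0 := Delta_gt0 s r01; have Dne := lt0r_neq0 D0.
have Dge := Delta_ge s r0.
pose d := (1 - r) ^+ 2.
have d0 : 0 < d by rewrite exprn_gt0 ?subr_gt0.
have d1 : d <= 1 by rewrite exprn_ile1 ?subr_ge0 ?gerBl// ltW.
have HJ := yb J; have HJ1 := yb J.+1.
have rJ0 : 0 <= r ^+ J by rewrite exprn_ge0.
have r1' := ltW r1.
have r2 : r ^+ 2 <= 1 by rewrite exprn_ile1.
have r20 : 0 <= r ^+ 2 by rewrite exprn_ge0.
have yJ1 : `|y J.+1| <= r ^+ J.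
  by rewrite (le_trans HJ1)// exprS ler_piMl.
have r2J : `|r ^+ 2 * y J| <= r ^+ J.
  by rewrite normrM (ger0_norm r20) (le_trans _ HJ)// ler_piMl.
have e0 : \sum_(1 <= j < J.+1) y j - Y0 = (r ^+ 2 * y J - y J.+1) / Delta r s.
  apply: (mulIf Dne); rewrite mulrBl /Y0 !divfK//.
  by rewrite mulrC (geom_rec_sum J Hy); ring.
have B0 : `|\sum_(1 <= j < J.+1) y j - Y0| <= 2 * r ^+ J / d.
  rewrite e0 normrM normfV (gtr0_norm D0) ler_pM ?invr_ge0 ?(ltW D0)//.
    by rewrite (le_trans (ler_normB _ _))// mulr2n mulrDl mul1r lerD.
  by rewrite lef_pV2 ?posrE.
have e1 : \sum_(1 <= j < J.+1) j%:R * y j - Y1 =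
   ((1 - r ^+ 2) * (\sum_(1 <= j < J.+1) y j - Y0) + r ^+ 2 * y J - J%:R * y J.+1
     + J%:R * (r ^+ 2 * y J)) / Delta r s.
  apply: (mulIf Dne); rewrite mulrBl /Y1 !divfK//.
  by rewrite mulrC (geom_rec_wsum J Hy); ring.
have d4 : (1 - r) ^+ 4 = d * d by rewrite /d; ring.
have eJE : eJ = 4 * (J.+1%:R * r ^+ J) / d / d.
  by rewrite /eJ d4; field; rewrite gt_eqF// subr_gt0.
have J0 : 0 <= J%:R :> R by [].
have JrJ : 0 <= J%:R * r ^+ J by rewrite mulr_ge0.
have dV : 1 <= d^-1 by rewrite invf_ge1.
have E2 : 4 * (J.+1%:R * r ^+ J) / d <= eJ.
  have q1 : 0 <= 4 * (J.+1%:R * r ^+ J) by rewrite !mulr_ge0.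
  by rewrite eJE ler_peMr// divr_ge0// ltW.
split.
  apply: (le_trans B0); apply: le_trans E2.
  by rewrite ler_pM2r ?invr_gt0// -natr1; lra.
rewrite e1 normrM normfV (gtr0_norm D0) eJE ler_pM ?invr_ge0 ?(ltW D0)//; last first.
  by rewrite lef_pV2 ?posrE.
apply: (le_trans (ler_normD _ _)).
have -> : 4 * (J.+1%:R * r ^+ J) / d = (2 * r ^+ J / d) + r ^+ J / d + J%:R * r ^+ J / d
   + J%:R * r ^+ J / d + (r ^+ J + 2 * (J%:R * r ^+ J)) / d.
  by rewrite -natr1; ring.
have rJd : r ^+ J <= r ^+ J / d by rewrite ler_peMr.
have JrJd : J%:R * r ^+ J <= J%:R * r ^+ J / d by rewrite ler_peMr.
have q0 : 0 <= (r ^+ J + 2 * (J%:R * r ^+ J)) / d.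
  by apply: divr_ge0; [apply: addr_ge0 => //; rewrite mulr_ge0 | exact: ltW].
rewrite -[leLHS]addr0; apply: lerD => //; apply: lerD; last first.
  by rewrite normrM (ger0_norm J0) (le_trans _ JrJd)// ler_wpM2l.
apply: (le_trans (ler_normB _ _)); apply: lerD; last first.
  by rewrite normrM (ger0_norm J0) (le_trans _ JrJd)// ler_wpM2l.
apply: (le_trans (ler_normD _ _)); apply: lerD; last by rewrite (le_trans r2J).
rewrite normrM (le_trans _ B0)// ler_piMl// ger0_norm ?subr_ge0//.
by rewrite gerBl.
Qed.
End TestFunction.

(** * A majorant of the sawtooth *)

Section Saw.
Variable R : realType.
Implicit Types (s t x c r d : R) (n m j : nat).

Lemma atan_le x : 0 <= x -> atan x <= x.
Proof.
move=> x0.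
have [] := @MVT_segment R (@atan R) (fun y => (1 + y ^+ 2)^-1) 0 x x0.
  by apply: derivable_within_continuous => y _; exact: derivable_atan.
move=> c _; rewrite atan0 !subr0 => E; rewrite E.
by rewrite ler_piMl// invf_le1 ?lerDl ?sqr_ge0// ltr_pwDl// sqr_ge0.
Qed.

(** From pi / 4 = atan (1/2) + atan (1/3) and atan x <= x. *)
Lemma pi_le_10_3 : pi <= 10 / 3 :> R.
Proof.
have h1 : atan (2^-1 : R) <= 2^-1 by apply: atan_le.
have h2 : atan (3^-1 : R) <= 3^-1 by apply: atan_le.
have p0 := @pi_ge2 R.
suff -> : pi = 4 * (atan 2^-1 + atan 3^-1) :> R by lra.
suff : pi / 4 = atan 2^-1 + atan 3^-1 :> R by lra.
have a0 : 0 <= atan (2^-1 : R) by rewrite -[leLHS](@atan0 R); apply: le_atan.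
have b0 : 0 <= atan (3^-1 : R) by rewrite -[leLHS](@atan0 R); apply: le_atan.
have c1 : cos (atan (2^-1 : R)) != 0.
  by rewrite gt_eqF// cos_gt0_pihalf// atan_gtNpi2 atan_ltpi2.
have c2 : cos (atan (3^-1 : R)) != 0.
  by rewrite gt_eqF// cos_gt0_pihalf// atan_gtNpi2 atan_ltpi2.
have c3 : cos (atan (2^-1 : R) + atan 3^-1) != 0.
  by rewrite gt_eqF// cos_gt0_pihalf//; apply/andP; split; lra.
apply: tan_inj.
- by rewrite in_itv /=; apply/andP; split; lra.
- by rewrite in_itv /=; apply/andP; split; lra.
by rewrite tan_piquarter tanD// !atanK; field.
Qed.

Variable r : R.
Hypothesis r01 : 0 < r < 1.

Let k1 : R := (1 - r ^+ 2) / (1 + r ^+ 2).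

(** The sum of r^j sin (j t) / j over j >= 1, that is, minus the argument of
    1 - r e^(it); on ]0, 2 pi[ it tends to the sawtooth (pi - t) / 2 as r
    tends to 1. *)
Definition atan_part t : R := atan (r * sin t / (1 - r * cos t)).
(** The weight k1 makes the two terms of order 1 - r cancel away from t = 0, so
    that the distance to the sawtooth has derivative proportional to
    (Delta r t)^(-2) instead of (Delta r t)^(-1). *)
Definition saw_major_odd t : R := pi^-1 * (atan_part t + k1 * (r * sin t / Delta r t)).
(** The added multiple of the Poisson kernel equals 1/2 at t = 0, which is
    exactly what the odd part lacks there. *)
Definition saw_major t : R := saw_major_odd t + (1 - r) ^+ 2 / (2 * Delta r t).

Let r0 : 0 < r. Proof. by case/andP: r01. Qed.
Let r1 : r < 1. Proof. by case/andP: r01. Qed.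
Let D0 t : 0 < Delta r t. Proof. by apply: Delta_gt0; rewrite ltW. Qed.

Lemma one_sub_rcos_gt0 t : 0 < 1 - r * cos t.
Proof. by have := cos_le1 t; have := r0; have := r1; nra. Qed.

Lemma is_derive_Delta t : is_derive t (1 : R) (fun t => Delta r t) (2 * r * sin t).
Proof. by rewrite /Delta; apply: is_derive_eq; rewrite /GRing.scale /=; ring. Qed.

Lemma is_derive_div (f g : R -> R) (df dg x : R) : g x != 0 ->
  is_derive x (1 : R) f df -> is_derive x (1 : R) g dg ->
  is_derive x (1 : R) (fun y => f y / g y) ((df * g x - f x * dg) / g x ^+ 2).
Proof.
move=> gx Hf Hg.
have Hv : is_derive x (1 : R) (fun y => (g y)^-1) (- (g x) ^- 2 *: dg).
  by apply: DeriveDef; [exact: derivableV | rewrite deriveV// derive_val].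
by apply: (is_derive_eq (is_deriveM Hf Hv)); rewrite /GRing.scale /=; field.
Qed.

Lemma is_derive_atan_part t :
  is_derive t (1 : R) atan_part ((r * cos t - r ^+ 2) / Delta r t).
Proof.
have h := one_sub_rcos_gt0 t; have hn := lt0r_neq0 h.
have d1 : is_derive t (1 : R) (fun t => r * sin t) (r * cos t).
  by apply: is_derive_eq; rewrite /GRing.scale /=; ring.
have d2 : is_derive t (1 : R) (fun t => 1 - r * cos t) (r * sin t).
  by apply: is_derive_eq; rewrite /GRing.scale /=; ring.
have d3 := @is_derive_div _ _ _ _ t hn d1 d2.
have d4 := @is_derive1_comp _ (@atan R) _ t _ _ (is_derive1_atan _) d3.
apply: (is_derive_eq d4).
have Dn := lt0r_neq0 (D0 t); move: Dn; rewrite /Delta.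
have := cos2Dsin2 t; move: hn.
set c := cos t; set z := sin t => hn cz Dn.
have zz : z ^+ 2 = 1 - c ^+ 2 by rewrite -cz; ring.
have e1 : 1 + (r * z / (1 - r * c)) ^+ 2 = (1 - 2 * r * c + r ^+ 2) / (1 - r * c) ^+ 2.
  apply: (mulIf (expf_neq0 2 hn)); rewrite divfK ?expf_neq0// mulrDl mul1r -exprMn divfK//.
  by rewrite exprMn zz; ring.
rewrite e1.
have -> : r * c * (1 - r * c) - r * z * (r * z) = r * c - r ^+ 2.
  by rewrite mulrACA -!expr2 zz; ring.
by field; rewrite hn Dn.
Qed.

Let V t := saw_major_odd t - (pi - t) / (2 * pi).
Let A : R := (1 - r ^+ 2) ^+ 3 / (2 * pi * (1 + r ^+ 2)).
Let r2p : 0 < 1 + r ^+ 2. Proof. by rewrite ltr_pwDl// sqr_ge0. Qed.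
Let pip : 0 < pi :> R. Proof. exact: pi_gt0. Qed.

Lemma is_derive_saw_diff t : is_derive t (1 : R) V (A / Delta r t ^+ 2).
Proof.
have Dn := lt0r_neq0 (D0 t).
have d1 : is_derive t (1 : R) (fun t => r * sin t) (r * cos t).
  by apply: is_derive_eq; rewrite /GRing.scale /=; ring.
have d2 := @is_derive_div _ _ _ _ t Dn d1 (is_derive_Delta t).
have d3 : is_derive t (1 : R) (fun t => (pi - t) / (2 * pi)) (- (2 * pi)^-1).
  by apply: is_derive_eq; rewrite /GRing.scale /=; ring.
have d4 := is_deriveB (is_deriveZ (pi^-1) (is_deriveD (is_derive_atan_part t)
  (is_deriveZ k1 d2))) d3.
apply: (is_derive_eq d4); rewrite /GRing.scale /= /k1 /A.
have pn := lt0r_neq0 pip; have rn := lt0r_neq0 r2p.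
move: Dn; rewrite /Delta.
have := cos2Dsin2 t; set c := cos t; set z := sin t => cz Dn.
have zz : z ^+ 2 = 1 - c ^+ 2 by rewrite -cz; ring.
have -> : r * c * (1 - 2 * r * c + r ^+ 2) - r * z * (2 * r * z) =
   r * c * (1 - 2 * r * c + r ^+ 2) - 2 * r ^+ 2 * (1 - c ^+ 2) by rewrite -zz; ring.
by move: pn; move: (pi : R) => p pn; field; rewrite Dn rn pn.
Qed.

Let V0 : V 0 = - 2^-1.
Proof.
rewrite /V /saw_major_odd /atan_part sin0 mulr0 !mul0r atan0 mulr0 addr0 mulr0 sub0r subr0.
by move: (lt0r_neq0 pip); move: (pi : R) => p pn; field.
Qed.

Let Vpi : V pi = 0.
Proof.
rewrite /V /saw_major_odd /atan_part sinpi mulr0 !mul0r atan0 mulr0 addr0 mulr0 sub0r subrr.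
by rewrite mul0r oppr0.
Qed.

Let A0 : 0 < A.
Proof.
apply: divr_gt0; last by rewrite !mulr_gt0.
by rewrite exprn_gt0// subr_gt0 expr_lt1// ltW.
Qed.

Let V_mvt x y : x <= y -> exists2 c, c \in `[x, y] & V y - V x = A / Delta r c ^+ 2 * (y - x).
Proof.
move=> xy; apply: (@MVT_segment R V (fun c => A / Delta r c ^+ 2) x y xy).
  by move=> z _; exact: is_derive_saw_diff.
by apply: derivable_within_continuous => z _; case: (is_derive_saw_diff z).
Qed.

Let V_mono x y : x <= y -> V x <= V y.
Proof.
move=> xy; have [c _ E] := V_mvt xy.
by rewrite -subr_ge0 E mulr_ge0 ?subr_ge0// divr_ge0 ?(ltW A0)// exprn_ge0// ltW.
Qed.

Let B t := (1 - r) ^+ 2 / (2 * Delta r t).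
Let B0 t : 0 <= B t.
Proof. by rewrite divr_ge0 ?sqr_ge0// mulr_ge0// ltW. Qed.

(** V vanishes at pi, so -V is the integral of A / Delta^2 from t to pi; as Delta
    is increasing on this range and Delta >= 1, it is at most the
    Poisson term B. *)
Let majorant_gap_right t : pi / 2 <= t <= pi -> 0 <= V t + B t.
Proof.
move=> /andP[t1 t2]; have [c] := V_mvt t2; rewrite in_itv /= => /andP[tc cpi].
rewrite Vpi sub0r => E.
have p2 : 0 < pi / 2 :> R by rewrite divr_gt0.
have m1 : (pi / 2 : R) \in `[0, pi]%R by rewrite in_itv /=; apply/andP; split; lra.
have m2 : t \in `[0, pi]%R by rewrite in_itv /=; apply/andP; split; lra.
have m3 : c \in `[0, pi]%R by rewrite in_itv /=; apply/andP; split; lra.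
have cost : cos t <= 0 by rewrite -cos_pihalf leNgt ltr_cos// -leNgt.
have cosc : cos c <= cos t by rewrite leNgt ltr_cos// -leNgt.
have Dt : 1 <= Delta r t by rewrite /Delta; have := r0; nra.
have Dc : Delta r t <= Delta r c by rewrite /Delta; have := r0; nra.
have -> : V t = - (A / Delta r c ^+ 2 * (pi - t)) by rewrite -E opprK.
rewrite addrC subr_ge0.
have DD : Delta r t <= Delta r c ^+ 2 by nra.
have h1 : A / Delta r c ^+ 2 <= A / Delta r t.
  by rewrite ler_pM2l// lef_pV2 ?posrE ?exprn_gt0.
have h2 : pi - t <= pi / 2 by lra.
apply: (@le_trans _ _ (A / Delta r t * (pi / 2))).
  by apply: ler_pM => //; [rewrite divr_ge0 ?(ltW A0) ?exprn_ge0 ?(ltW (D0 _)) | rewrite subr_ge0].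
rewrite /B invfM (mulrA ((1 - r) ^+ 2)) (mulrAC A) ler_pM2r ?invr_gt0//.
rewrite /A.
have -> : (1 - r ^+ 2) ^+ 3 / (2 * pi * (1 + r ^+ 2)) * (pi / 2) =
   (1 - r ^+ 2) ^+ 3 / (1 + r ^+ 2) / 2 / 2 
  by move: (lt0r_neq0 r2p) (lt0r_neq0 pip); move: (pi : R) => p rn pn; field; rewrite rn pn.
have -> : (1 - r) ^+ 2 / 2 = 2 * (1 - r) ^+ 2 / 2 / 2 by field.
rewrite !ler_pM2r ?invr_gt0// ler_pdivrMr//.
have -> : (1 - r ^+ 2) ^+ 3 = (1 - r) ^+ 2 * ((1 - r ^+ 2) * (1 + r) ^+ 2) by ring.
have -> : 2 * (1 - r) ^+ 2 * (1 + r ^+ 2) = (1 - r) ^+ 2 * (2 * (1 + r ^+ 2)) by ring.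
rewrite ler_wpM2l ?sqr_ge0//.
have h3 : 0 <= 1 - r ^+ 2 by rewrite subr_ge0 exprn_ile1 ?ltW.
have h4 : (1 + r) ^+ 2 <= 2 * (1 + r ^+ 2) by have := sqr_ge0 (1 - r); lra.
apply: le_trans h4; rewrite ler_piMl ?sqr_ge0// gerBl sqr_ge0.
by [].
Qed.

(** The derivative of V + B has the sign of A - (1 - r)^2 r sin t, which is
    decreasing in t on [0, pi/2]: V + B increases and then decreases, so it is
    bounded below by its values at the ends, 0 and a nonnegative number. *)
Let majorant_gap_left t : 0 <= t <= pi / 2 -> 0 <= V t + B t.
Proof.
move=> /andP[t0 t2].
have dE x : is_derive x (1 : R) (fun t => V t + B t)
   ((A - (1 - r) ^+ 2 * r * sin x) / Delta r x ^+ 2).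
  have Dn : 2 * Delta r x != 0 by rewrite mulf_neq0// gt_eqF.
  have d1 : is_derive x (1 : R) (fun x => 2 * Delta r x) (2 * (2 * r * sin x)).
    exact: is_deriveZ (is_derive_Delta x).
  have d2 := @is_derive_div _ _ _ _ x Dn (is_derive_cst ((1 - r) ^+ 2) x 1) d1.
  apply: (is_derive_eq (is_deriveD (is_derive_saw_diff x) d2)).
  have Dn' := lt0r_neq0 (D0 x); rewrite /cst /=; move: A (Delta r x) Dn' => a D Dn'.
  by field; rewrite Dn'.
have mvt x y : x <= y -> exists2 c, c \in `[x, y] & (V y + B y) - (V x + B x) =
   (A - (1 - r) ^+ 2 * r * sin c) / Delta r c ^+ 2 * (y - x).
  move=> xy; apply: (@MVT_segment R (fun t => V t + B t)
    (fun c => (A - (1 - r) ^+ 2 * r * sin c) / Delta r c ^+ 2) x y xy).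
  by apply: derivable_within_continuous => z _; case: (dE z).
have p2 : 0 < pi / 2 :> R by rewrite divr_gt0.
have k0 : 0 <= (1 - r) ^+ 2 * r by rewrite mulr_ge0 ?sqr_ge0// ltW.
have smono x y : 0 <= x -> x <= y -> y <= pi / 2 -> sin x <= sin y.
  move=> x0 xy y2.
  have m1 : x \in `[(- (pi/2)), pi/2]%R by rewrite in_itv /=; apply/andP; split; lra.
  have m2 : y \in `[(- (pi/2)), pi/2]%R by rewrite in_itv /=; apply/andP; split; lra.
  by rewrite leNgt ltr_sin// -leNgt.
have [h|h] := leP 0 (A - (1 - r) ^+ 2 * r * sin t).
- have [c] := mvt _ _ t0; rewrite in_itv /= => /andP[c0 ct] E.
  have E0 : V 0 + B 0 = 0.
    have DE : Delta r 0 = (1 - r) ^+ 2 by rewrite /Delta cos0; ring.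
    have := lt0r_neq0 (D0 0); rewrite V0 /B DE; move: ((1 - r) ^+ 2) => D Dn.
    by field.
  rewrite E0 subr0 subr0 in E; rewrite E.
  rewrite mulr_ge0// divr_ge0 ?exprn_ge0 ?(ltW (D0 _))// (le_trans h)//.
  by rewrite lerD2l lerN2 ler_wpM2l// smono.
- have [c] := mvt _ _ t2; rewrite in_itv /= => /andP[ct c2] E.
  have pp : 0 <= V (pi / 2) + B (pi / 2).
    by apply: majorant_gap_right; rewrite lexx /=; lra.
  have : (V (pi / 2) + B (pi / 2)) - (V t + B t) <= 0.
    rewrite E mulr_le0_ge0 ?subr_ge0// ler_pdivrMr ?exprn_gt0// mul0r.
    apply: le_trans (ltW h).
    by rewrite lerD2l lerN2 ler_wpM2l// smono.
  lra.
Qed.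

(** On [pi, 2 pi] the odd part alone is enough, V being increasing from
    V pi = 0. *)
Lemma saw_major_ge t : 0 <= t <= 2 * pi -> (pi - t) / (2 * pi) <= saw_major t.
Proof.
move=> /andP[t0 t2]; rewrite -subr_ge0 /saw_major addrAC -/(V t) -/(B t).
have [tpi|pit] := leP t pi; last first.
  by rewrite addr_ge0// -Vpi V_mono// ltW.
have [th|th] := leP t (pi / 2); first by apply: majorant_gap_left; rewrite t0.
by apply: majorant_gap_right; rewrite tpi (ltW th).
Qed.
End Saw.

(** * The frequency-weighted majorant *)

Section SawBound.
Variable R : realType.
Implicit Types (s t x c r d : R) (n m j : nat).

(** After replacing z and c by their absolute values the difference of the two
    sides is increasing in 1/pi on [3/10, +oo[, and at 1/pi = 3/10 the maximum
    of the left-hand side over the circle is at most 144/100. *)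
Lemma trig_form_le (z c q : R) : z ^+ 2 + c ^+ 2 = 1 -> 0 <= q ->
  0 <= 1 + q * c <= 1 + q -> q <= 1 ->
  pi^-1 * (z * (2 + q * c)) + c * (1 + q * c) / (1 + q) <= 16 / pi ^+ 2.
Proof.
move=> zc q0 /andP[w0 w1] q1.
have p103 := @pi_le_10_3 R; have p0 := @pi_gt0 R.
pose u : R := pi^-1.
have u0 : 3 / 10 <= u.
  by rewrite /u -[3 / 10]invrK lef_pV2 ?posrE// ?invr_gt0// invf_div.
have -> : 16 / pi ^+ 2 = 16 * u ^+ 2 :> R by rewrite /u exprVn.
rewrite -/u.
have [z1 z2] : `|z| ^+ 2 = z ^+ 2 /\ `|c| ^+ 2 = c ^+ 2 by rewrite !real_normK ?num_real.
have zn := normr_ge0 z; have cn := normr_ge0 c.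
have zc' : `|z| ^+ 2 + `|c| ^+ 2 = 1 by rewrite z1 z2.
have h1 : z * (2 + q * c) <= `|z| * (2 + `|c|).
  have qc : q * c <= `|c|.
    by rewrite (le_trans (ler_norm _))// normrM (ger0_norm q0) ler_piMl.
  apply: (@le_trans _ _ (`|z| * (2 + q * c))).
    by rewrite ler_wpM2r ?ler_norm//; lra.
  by rewrite ler_wpM2l// lerD2l.
have h2 : c * (1 + q * c) / (1 + q) <= `|c|.
  rewrite ler_pdivrMr; last by lra.
  apply: (@le_trans _ _ (`|c| * (1 + q * c))).
    by rewrite ler_wpM2r ?ler_norm.
  by rewrite ler_wpM2l.
move: (`|z|) (`|c|) zn cn zc' h1 h2 => a b a0 b0 ab h1 h2.
have h3 : u * (z * (2 + q * c)) <= u * (a * (2 + b)) by rewrite ler_wpM2l//; lra.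
have a1 : a <= 1 by nra.
have b1 : b <= 1 by nra.
have X3 : a * (2 + b) <= 3 by nra.
have k1 : 2 * a * b <= 1 by have := sqr_ge0 (a - b); nra.
have k2 : 3 / 5 * a + b <= 118 / 100.
  have := sqr_ge0 (a - 1 / 2); have := sqr_ge0 (b - 86 / 100); nra.
have k3 : 3 / 10 * (a * (2 + b)) + b <= 144 / 100 by nra.
have k4 : (u - 3 / 10) * (a * (2 + b)) <= (u - 3 / 10) * 3 by rewrite ler_wpM2l//; lra.
nra.
Qed.

Variable r : R.
Hypothesis r01 : 0 < r < 1.
Let d : R := (1 - r) / (1 + r).
Let k1 : R := (1 - r ^+ 2) / (1 + r ^+ 2).
Let r0 : 0 < r. Proof. by case/andP: r01. Qed.
Let r1 : r < 1. Proof. by case/andP: r01. Qed.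
Let r01' : 0 <= r < 1. Proof. by rewrite ltW. Qed.
Let D0 t : 0 < Delta r t. Proof. by apply: Delta_gt0; rewrite ltW. Qed.

(** [sin_sum], [sin_wsum] and [cos_wsum] are the sums over j >= 1 of
    r^j sin (j s), j r^j sin (j s) and j r^j cos (j s). *)
Definition sin_sum s : R := r * sin s / Delta r s.
Definition sin_wsum s : R := (1 - r ^+ 2) * sin_sum s / Delta r s.
Definition cos_wsum s : R :=
  ((1 - r ^+ 2) * ((r * cos s - r ^+ 2) / Delta r s) - r ^+ 2) / Delta r s.

(** The left-hand side is the Fourier series of [saw_major] with its j-th
    coefficient multiplied by j.  In the coordinates z and c it becomes a
    quadratic expression on the unit circle. *)
Lemma saw_major_freq_le s :
  pi^-1 * (sin_sum s + k1 * sin_wsum s) + d * cos_wsum s <= 4 / (pi ^+ 2 * d).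
Proof.
have p0 := @pi_gt0 R.
have Dn := lt0r_neq0 (D0 s).
have rn := lt0r_neq0 r0.
have q1 : 0 < 1 - r ^+ 2 by rewrite subr_gt0 expr_lt1// ltW.
have q2 : 0 < 1 + r ^+ 2 by rewrite ltr_pwDl// sqr_ge0.
have q3 : 0 < 1 + r by rewrite addr_gt0.
have q4 : 0 < 1 - r by rewrite subr_gt0.
have [n1 n2 n3 n4] : [/\ 1 - r ^+ 2 != 0, 1 + r ^+ 2 != 0, 1 + r != 0 & 1 - r != 0].
  by rewrite !gt_eqF.
(* z and c are the imaginary and real parts of the image of e^(is) under the
   automorphism of the disc that carries r to 0 *)
pose z := (1 - r ^+ 2) * sin s / Delta r s.
pose c := ((1 - r ^+ 2) ^+ 2 / Delta r s - (1 + r ^+ 2)) / (2 * r).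
pose q := 2 * r / (1 + r ^+ 2).
have zz : sin s ^+ 2 = 1 - cos s ^+ 2 by rewrite -(cos2Dsin2 s); ring.
have ce : cos s = (1 + r ^+ 2 - Delta r s) / (2 * r) by rewrite /Delta; field.
have e1 : z ^+ 2 + c ^+ 2 = 1.
  rewrite /z !exprMn zz ce /c; move: (Delta r s) Dn => D Dn; field.
  by rewrite ?Dn ?rn.
have e2 : 1 + q * c = (1 - r ^+ 2) ^+ 2 / (Delta r s * (1 + r ^+ 2)).
  rewrite /q /c; move: (Delta r s) Dn => D Dn; field.
  by rewrite ?Dn ?rn ?n2.
have e3 : 1 + q = (1 + r) ^+ 2 / (1 + r ^+ 2) by rewrite /q; field.
have w0 : 0 <= 1 + q * c by rewrite e2 divr_ge0 ?sqr_ge0// mulr_ge0 ?ltW.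
have w1 : 1 + q * c <= 1 + q.
  rewrite e2 e3 invfM mulrA ler_pM2r ?invr_gt0// ler_pdivrMr//.
  have -> : (1 - r ^+ 2) ^+ 2 = (1 + r) ^+ 2 * (1 - r) ^+ 2 by ring.
  by rewrite ler_wpM2l ?sqr_ge0// Delta_ge// ltW.
have qq0 : 0 <= q by rewrite divr_ge0 ?mulr_ge0 ?ltW.
have qq1 : q <= 1 by rewrite ler_pdivrMr// mul1r; have := sqr_ge0 (1 - r); nra.
have w : 0 <= 1 + q * c <= 1 + q by rewrite w0.
have := trig_form_le e1 qq0 w qq1.
have -> : pi^-1 * (sin_sum s + k1 * sin_wsum s) + d * cos_wsum s =
   r / (1 - r ^+ 2) * (pi^-1 * (z * (2 + q * c)) + c * (1 + q * c) / (1 + q)).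
  have -> : 2 + q * c = 1 + (1 + q * c) by ring.
  rewrite e3 e2 [RHS]mulrDr; congr (_ + _).
    rewrite [RHS]mulrCA; congr (_ * _); rewrite /sin_wsum /sin_sum /k1 /z.
    by move: (Delta r s) (sin s) Dn => D S Dn; field; rewrite n2 Dn n1.
  rewrite /cos_wsum /d ce /c; move: (Delta r s) Dn => D Dn; field.
  by rewrite ?Dn ?rn ?n1 ?n2 ?n3.
move: (_ + _) => X hX.
have h : r / (1 - r ^+ 2) <= (4 * d)^-1.
  rewrite /d.
  have -> : (4 * ((1 - r) / (1 + r)))^-1 = (1 + r) ^+ 2 / 4 / (1 - r ^+ 2).
    by field; rewrite ?n1 ?n3 ?n4.
  rewrite ler_pM2r ?invr_gt0// ler_pdivlMr//; have := sqr_ge0 (1 - r); nra.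
have d0 : 0 < d by rewrite divr_gt0.
apply: (@le_trans _ _ (r / (1 - r ^+ 2) * (16 / pi ^+ 2))).
  by rewrite ler_wpM2l// divr_ge0 ?ltW.
apply: (@le_trans _ _ ((4 * d)^-1 * (16 / pi ^+ 2))).
  by rewrite ler_wpM2r// divr_ge0// exprn_ge0// ltW.
move: (lt0r_neq0 p0) (lt0r_neq0 d0); move: (pi : R) d => p d' pn dn.
by rewrite le_eqVlt; apply/orP; left; apply/eqP; field; rewrite ?pn ?dn.
Qed.
End SawBound.

(** * Sawtooth sums over unimodular zeros *)

Section SawSum.
Variable R : realType.
Implicit Types (s t x c r d : R) (n m j : nat).

(** With q = r^(1/2), the factor J.+1 q^J stays below the sum of the geometric
    series of ratio q, and a factor q^J remains. *)
Lemma small_lin_expr r C e : 0 <= r < 1 -> 0 < e ->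
  exists J : nat, C * (J.+1%:R * r ^+ J) <= e.
Proof.
move=> /andP[r0 r1] e0.
pose q := Num.sqrt r.
have q0 : 0 <= q by exact: sqrtr_ge0.
have q1 : q < 1 by rewrite -sqrtr1 ltr_sqrt.
have qq : q ^+ 2 = r by rewrite sqr_sqrtr.
have B J : J.+1%:R * q ^+ J <= (1 - q)^-1.
  rewrite -[leRHS]mul1r ler_pdivlMr ?subr_gt0//.
  apply: (@le_trans _ _ ((1 - q) * \sum_(i < J.+1) q ^+ i)).
    rewrite mulrC ler_wpM2l ?subr_ge0 ?(ltW q1)//.
    rewrite -[J.+1 in leLHS]card_ord mulr_natl -sumr_const; apply: ler_sum => i _.
    by rewrite ler_wiXn2l ?(ltW q1)// -ltnS.
  by rewrite -opprB mulNr -subrX1 opprB gerBl exprn_ge0.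
have [|K HK] := @small_expr R q (`|C| / (1 - q)) e _ e0; first by rewrite q0.
exists K; apply: le_trans (HK K (leqnn _)).
rewrite -qq -exprM mulnC exprM -mulrA.
apply: (@le_trans _ _ (`|C| * (K.+1%:R * (q ^+ K) ^+ 2))).
  by rewrite ler_wpM2r ?ler_norm// mulr_ge0// sqr_ge0.
rewrite ler_wpM2l// expr2 mulrA ler_wpM2r ?exprn_ge0//; exact: B.
Qed.

Lemma sin_rec r t j : r ^+ j.+2 * sin (j.+2%:R * t) =
  2 * r * cos t * (r ^+ j.+1 * sin (j.+1%:R * t)) - r ^+ 2 * (r ^+ j * sin (j%:R * t)).
Proof.
have -> : j.+2%:R * t = j.+1%:R * t + t by rewrite -natr1; ring.
have -> : j%:R * t = j.+1%:R * t - t by rewrite -[j.+1%:R]natr1; ring.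
by move: (j.+1%:R * t) => u; rewrite (sinB u) (sinD u) !exprS; ring.
Qed.

Lemma cos_rec r t j : r ^+ j.+2 * cos (j.+2%:R * t) =
  2 * r * cos t * (r ^+ j.+1 * cos (j.+1%:R * t)) - r ^+ 2 * (r ^+ j * cos (j%:R * t)).
Proof.
have -> : j.+2%:R * t = j.+1%:R * t + t by rewrite -natr1; ring.
have -> : j%:R * t = j.+1%:R * t - t by rewrite -[j.+1%:R]natr1; ring.
by move: (j.+1%:R * t) => u; rewrite (cosB u) (cosD u) !exprS; ring.
Qed.

Lemma sin_sums_approx r t J : 0 <= r < 1 ->
  let eJ := 4 / (1 - r) ^+ 4 * (J.+1%:R * r ^+ J) in
  `|\sum_(1 <= j < J.+1) r ^+ j * sin (j%:R * t) - sin_sum r t| <= eJ /\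
  `|\sum_(1 <= j < J.+1) j%:R * (r ^+ j * sin (j%:R * t)) - sin_wsum r t| <= eJ.
Proof.
move=> r01 eJ.
have yb j : `|r ^+ j * sin (j%:R * t)| <= r ^+ j.
  have /andP[r0 _] := r01.
  by rewrite normrM ger0_norm ?exprn_ge0// ler_piMr ?exprn_ge0// sin_max.
have := @geom_sums_approx R (fun j => r ^+ j * sin (j%:R * t)) t r J r01 (sin_rec r t) yb.
rewrite /= mul0r sin0 !mulr0 !subr0 expr1 mul1r; exact.
Qed.

Lemma cos_sums_approx r t J : 0 <= r < 1 ->
  let eJ := 4 / (1 - r) ^+ 4 * (J.+1%:R * r ^+ J) in
  `|\sum_(1 <= j < J.+1) r ^+ j * cos (j%:R * t) - (r * cos t - r ^+ 2) / Delta r t| <= eJ /\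
  `|\sum_(1 <= j < J.+1) j%:R * (r ^+ j * cos (j%:R * t)) - cos_wsum r t| <= eJ.
Proof.
move=> r01 eJ.
have yb j : `|r ^+ j * cos (j%:R * t)| <= r ^+ j.
  have /andP[r0 _] := r01.
  by rewrite normrM ger0_norm ?exprn_ge0// ler_piMr ?exprn_ge0// cos_max.
have := @geom_sums_approx R (fun j => r ^+ j * cos (j%:R * t)) t r J r01 (cos_rec r t) yb.
by rewrite /= mul0r cos0 expr0 !mulr1 expr1 mul1r; exact.
Qed.

(** The truncated series and [atan_part] vanish at t = 0, and their t-derivatives
    are a truncated and a full geometric sum. *)
Lemma atan_sum_approx r t J : 0 < r < 1 -> 0 <= t ->
  `|\sum_(1 <= j < J.+1) r ^+ j / j%:R * sin (j%:R * t) - atan_part r t|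
   <= 4 / (1 - r) ^+ 4 * (J.+1%:R * r ^+ J) * t.
Proof.
move=> r01 t0; have r01' : 0 <= r < 1 by case/andP: r01 => /ltW -> ->.
pose F t := \sum_(1 <= j < J.+1) r ^+ j / j%:R * sin (j%:R * t) - atan_part r t.
pose dF t := \sum_(1 <= j < J.+1) r ^+ j * cos (j%:R * t) - (r * cos t - r ^+ 2) / Delta r t.
have dFE x : is_derive x (1 : R) F (dF x).
  apply: is_deriveB; last exact: is_derive_atan_part.
  apply: (@is_derive_bigsum R (fun j t => r ^+ j / j%:R * sin (j%:R * t))) => j /andP[j0 _].
  have j0' : j%:R != 0 :> R by rewrite pnatr_eq0 -lt0n.
  have d1 : is_derive x (1 : R) (fun t => j%:R * t) j%:R.
    by apply: is_derive_eq; rewrite /GRing.scale /= mulr1 ?mulr0 ?add0r ?addr0.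
  have d2 := @is_derive1_comp _ (@sin R) _ x _ _ (is_derive_sin _) d1.
  apply: (is_derive_eq (is_deriveZ (r ^+ j / j%:R) d2)); rewrite /GRing.scale /=.
  by field.
have [] := @MVT_segment R F dF 0 t t0.
- by apply: derivable_within_continuous => z _; case: (dFE z).
move=> c _.
have F0 : F 0 = 0.
  rewrite /F /atan_part sin0 mulr0 mul0r atan0 subr0.
  by rewrite big1// => j _; rewrite mulr0 sin0 mulr0.
rewrite F0 !subr0 => E; rewrite -/(F t) E normrM (ger0_norm t0) ler_wpM2r//.
by have [] := cos_sums_approx c J r01'.
Qed.

(** [log_mean_pos] is applied to a constant minus twice the truncated series of
    [saw_major], its j-th coefficient multiplied by j: the factor 1/j in
    [log_mean_pos] then gives back [saw_major] itself, up to its mean d / 2.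
    The constant 8 / pi^2 is twice the one of [saw_major_freq_le]. *)
Lemma sawtooth_sum_le (th : seq R) L d : 0 <= L -> 0 < d < 1 ->
  (forall x, x \in th -> 0 <= x <= 2 * pi) ->
  (forall r t, 0 <= r < 1 -> \sum_(x <- th) ln (Delta r (t - x)) <= 2 * L) ->
  \sum_(x <- th) (pi - x) / (2 * pi) <= (size th)%:R * (d / 2) + 8 * L / (pi ^+ 2 * d).
Proof.
move=> L0 /andP[d0 d1] Hth HL.
have p0 := @pi_gt0 R; have p2 := @pi_ge2 R.
(* the radius for which d = (1 - r) / (1 + r) *)
pose r := (1 - d) / (1 + d).
have dp : 0 < 1 + d by rewrite addr_gt0.
have r0 : 0 < r by rewrite divr_gt0// subr_gt0.
have r1 : r < 1 by rewrite ltr_pdivrMr// mul1r; lra.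
have r01 : 0 < r < 1 by rewrite r0.
have r01' : 0 <= r < 1 by rewrite ltW.
have dE : (1 - r) / (1 + r) = d.
  have dn := lt0r_neq0 dp.
  have -> : 1 - r = 2 * d / (1 + d) by rewrite /r; field.
  have -> : 1 + r = 2 / (1 + d) by rewrite /r; field.
  by field.
pose k1 := (1 - r ^+ 2) / (1 + r ^+ 2).
have r2 : 0 < r ^+ 2 < 1 by rewrite exprn_gt0// expr_lt1// ltW.
have k10 : 0 <= k1 by case/andP: r2 => ? ?; rewrite divr_ge0; lra.
have k11 : k1 <= 1 by case/andP: r2 => ? ?; rewrite /k1 ler_pdivrMr; lra.
have pV0 : 0 < pi^-1 :> R by rewrite invr_gt0.
have pV : pi^-1 <= 2^-1 :> R by rewrite lef_pV2 ?posrE.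
apply/ler_addgt0Pr => e' e'0.
pose e := e' / (4 * ((size th)%:R + L) + 1).
have sl : 0 < 4 * ((size th)%:R + L) + 1 by rewrite ltr_wpDl// mulr_ge0// addr_ge0.
have e0 : 0 < e by rewrite divr_gt0.
have pe : pi^-1 * e <= 2^-1 * e by rewrite ler_wpM2r// ltW.
have [J HJ] := @small_lin_expr r (4 / (1 - r) ^+ 4) e r01' e0.
pose K1 : R := 4 / (pi ^+ 2 * d).
pose g0 := 2 * (K1 + 2 * e).
pose a j : R := - 2 * d * (j%:R * r ^+ j).
pose b j : R := - 2 * pi^-1 * (r ^+ j + k1 * (j%:R * r ^+ j)).
have gpos t : 0 <= trig_poly J g0 a b t.
  pose S0 := \sum_(1 <= j < J.+1) r ^+ j * sin (j%:R * t).
  pose S1 := \sum_(1 <= j < J.+1) j%:R * (r ^+ j * sin (j%:R * t)).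
  pose C1 := \sum_(1 <= j < J.+1) j%:R * (r ^+ j * cos (j%:R * t)).
  have -> : trig_poly J g0 a b t = g0 - 2 * (pi^-1 * (S0 + k1 * S1) + d * C1).
    rewrite /trig_poly; congr (_ + _).
    rewrite /S0 /S1 /C1 [k1 * _]mulr_sumr -big_split /= !mulr_sumr -big_split /= mulr_sumr -sumrN.
    by apply: eq_bigr => j _; rewrite /a /b; ring.
  have [h1 h2] := sin_sums_approx t J r01'; have [_ h3] := cos_sums_approx t J r01'.
  have {}h1 := le_trans h1 HJ; have {}h2 := le_trans h2 HJ; have {}h3 := le_trans h3 HJ.
  have := saw_major_freq_le r01 t; rewrite dE -/k1 -/K1.
  move: h1 h2 h3; rewrite -/S0 -/S1 -/C1 !ler_norml.
  move: (sin_sum r t) (sin_wsum r t) (cos_wsum r t) => s0 s1 c1.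
  move=> /andP[_ h1] /andP[_ h2] /andP[_ h3] hK.
  have t1 : k1 * (S1 - s1) <= e.
    by apply: le_trans (_ : k1 * e <= _); [rewrite ler_wpM2l|rewrite ler_piMl// ltW].
  have t2 : d * (C1 - c1) <= e.
    by apply: le_trans (_ : d * e <= _); [rewrite ler_wpM2l// ltW|rewrite ler_piMl// ltW].
  have t3 : pi^-1 * (S0 - s0 + k1 * (S1 - s1)) <= e.
    apply: (@le_trans _ _ (pi^-1 * (2 * e))); first by rewrite ler_wpM2l ?(ltW pV0)//; lra.
    by lra.
  rewrite /g0; lra.
have := log_mean_pos HL gpos.
pose P x := \sum_(1 <= j < J.+1) r ^+ j / j%:R * sin (j%:R * x).
pose S0 x := \sum_(1 <= j < J.+1) r ^+ j * sin (j%:R * x).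
pose C0 x := \sum_(1 <= j < J.+1) r ^+ j * cos (j%:R * x).
have -> : - (\sum_(x <- th) \sum_(1 <= j < J.+1)
       j%:R^-1 * (a j * cos (j%:R * x) + b j * sin (j%:R * x))) =
   \sum_(x <- th) 2 * (pi^-1 * (P x + k1 * S0 x) + d * C0 x).
  rewrite -sumrN; apply: eq_bigr => x _.
  rewrite /S0 /P /C0 [k1 * _]mulr_sumr -big_split /= !mulr_sumr -big_split /= mulr_sumr -sumrN.
  apply: eq_big_nat => j /andP[j0 _]; rewrite /a /b.
  have jn : j%:R != 0 :> R by rewrite pnatr_eq0 -lt0n.
  by move: (pi^-1) => u; field.
have low x : x \in th -> (pi - x) / (2 * pi) - d / 2 - 4 * e <=
   pi^-1 * (P x + k1 * S0 x) + d * C0 x.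
  move=> /Hth xr; have /andP[x0 x2] := xr.
  apply: (@le_trans _ _ (saw_major r x - d / 2 - 4 * e)).
    by rewrite !lerD2r saw_major_ge.
  rewrite /saw_major /saw_major_odd -/k1 -/(sin_sum r x).
  have -> : (1 - r) ^+ 2 / (2 * Delta r x) = d / 2 + d * ((r * cos x - r ^+ 2) / Delta r x).
    have := lt0r_neq0 (Delta_gt0 x r01'); rewrite -dE /Delta => Dn.
    by field; rewrite Dn /= gt_eqF// addr_gt0.
  have [h1 _] := sin_sums_approx x J r01'; have [h3 _] := cos_sums_approx x J r01'.
  have {}h1 := le_trans h1 HJ; have {}h3 := le_trans h3 HJ.
  have h2 := atan_sum_approx J r01 x0.
  have {}h2 : `|P x - atan_part r x| <= e * x.
    by apply: le_trans h2 _; rewrite ler_wpM2r.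
  move: h1 h2 h3; rewrite -/(S0 x) -/(C0 x) !ler_norml.
  move: (sin_sum r x) (atan_part r x) (_ / Delta r x) => s0 at0 c0.
  move=> /andP[h1 _] /andP[h2 _] /andP[h3 _].
  have t1 : - e <= k1 * (S0 x - s0).
    by apply: (@le_trans _ _ (k1 * - e)); [rewrite mulrN lerN2 ler_piMl// ltW|rewrite ler_wpM2l].
  have t2 : - e <= d * (C0 x - c0).
    apply: (@le_trans _ _ (d * - e)); first by rewrite mulrN lerN2 ler_piMl// ltW.
    by rewrite ler_wpM2l// ltW.
  have t3 : - (3 * e) <= pi^-1 * (P x - at0 + k1 * (S0 x - s0)).
    apply: (@le_trans _ _ (pi^-1 * - (e * (2 * pi) + e))).
      have -> : pi^-1 * - (e * (2 * pi) + e) = - (2 * e) - pi^-1 * e.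
        by move: (lt0r_neq0 p0); move: (pi : R) => p pn; field.
      lra.
    rewrite ler_wpM2l ?(ltW pV0)//.
    have : e * x <= e * (2 * pi) by rewrite ler_wpM2l// ltW.
    lra.
  lra.
move=> HH.
have : \sum_(x <- th) 2 * ((pi - x) / (2 * pi) - d / 2 - 4 * e) <= 2 * L * g0.
  apply: le_trans HH; rewrite [leLHS]big_seq [leRHS]big_seq.
  by apply: ler_sum => x xth; rewrite ler_pM2l// low.
rewrite -mulr_sumr !sumrB !big_const_seq !count_predT !iter_addr_0.
rewrite -(mulr_natl (d / 2)) -(mulr_natl (4 * e)).
have -> : 8 * L / (pi ^+ 2 * d) = 2 * L * K1 by rewrite /K1; ring.
have ee : e * (4 * ((size th)%:R + L) + 1) = e' by rewrite /e divfK// gt_eqF.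
move: (\sum_(x <- th) _) => S; rewrite /g0; move: e0 L0 ee.
lra.
Qed.
End SawSum.

(** * The unit circle and the maximum principle *)

Section Complex.
Local Open Scope complex_scope.
Variable R : realType.
Implicit Types (s t x r : R) (z w : R[i]) (p : {poly R[i]}).

Lemma sqr_normc z : normc z ^+ 2 = complex.Re z ^+ 2 + complex.Im z ^+ 2.
Proof. by case: z => a b /=; rewrite sqr_sqrtr// addr_ge0// sqr_ge0. Qed.

Lemma normc_ge0 z : 0 <= normc z.
Proof. by case: z => a b; exact: sqrtr_ge0. Qed.

Lemma normc_gt0 z : z != 0 -> 0 < normc z.
Proof.
move=> z0; rewrite lt_neqAle normc_ge0 andbT eq_sym; apply: contra z0 => /eqP.
by move=> /ComplexField.Normc.eq0_normc ->.
Qed.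

Lemma normcX z n : normc (z ^+ n) = normc z ^+ n.
Proof.
elim: n => [|n IH]; first by rewrite !expr0 ComplexField.Normc.normc1.
by rewrite !exprS ComplexField.Normc.normcM IH.
Qed.

Lemma normc_prod (T : Type) (s : seq T) (F : T -> R[i]) :
  normc (\prod_(i <- s) F i) = \prod_(i <- s) normc (F i).
Proof.
elim: s => [|a s IH]; first by rewrite !big_nil ComplexField.Normc.normc1.
by rewrite !big_cons ComplexField.Normc.normcM IH.
Qed.

Lemma normc_sum n (F : 'I_n -> R[i]) :
  normc (\sum_(i < n) F i) <= \sum_(i < n) normc (F i).
Proof.
elim: n F => [|n IH] F; first by rewrite !big_ord0 ComplexField.Normc.normc0.
by rewrite !big_ord_recr /= (le_trans (le_normcD _ _))// lerD2r.
Qed.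

Lemma normc_real x : normc x%:C = `|x|.
Proof. by rewrite /= expr0n /= addr0 sqrtr_sqr. Qed.

Lemma expiD s t : expi (s + t) = expi s * expi t.
Proof.
apply/eqP; rewrite /expi eq_complex /= cosD sinD.
by rewrite eqxx /= addrC eqxx.
Qed.

Lemma expi0 : expi (0 : R) = 1.
Proof. by apply/eqP; rewrite /expi cos0 sin0 eq_complex /= !eqxx. Qed.

Lemma expiX t n : expi t ^+ n = expi (n%:R * t).
Proof.
elim: n => [|n IH]; first by rewrite expr0 mul0r expi0.
by rewrite exprS IH -expiD -[in RHS]natr1 mulrDl mul1r addrC.
Qed.

Lemma normc_expi t : normc (expi t) = 1.
Proof. by rewrite /= cos2Dsin2 sqrtr1. Qed.

Lemma expi_neq0 t : expi t != 0.
Proof.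
apply/eqP => h; have := normc_expi t; rewrite h ComplexField.Normc.normc0 => /eqP.
by rewrite eq_sym oner_eq0.
Qed.

Lemma Re_sum n (F : 'I_n -> R[i]) : complex.Re (\sum_(i < n) F i) = \sum_(i < n) complex.Re (F i).
Proof. by elim/big_rec2: _ => //= i x y _ <-; case: (F i) => a b; case: y. Qed.

Lemma Im_sum n (F : 'I_n -> R[i]) : complex.Im (\sum_(i < n) F i) = \sum_(i < n) complex.Im (F i).
Proof. by elim/big_rec2: _ => //= i x y _ <-; case: (F i) => a b; case: y. Qed.

Lemma node_sum_expi N q c : (0 < q < N)%N ->
  \sum_(l < N) expi (q%:R * node R N l + c) = 0.
Proof.
move=> qN; apply/eqP; rewrite eq_complex Re_sum Im_sum /=; apply/andP; split; apply/eqP.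
  exact: node_sum_cos.
rewrite -[RHS](node_sum_cos (c - pi / 2) qN); apply: eq_bigr => l _.
by rewrite addrA cosBpihalf.
Qed.

(** The j-th coefficient is the mean over nodes of p(z) z^(-j), the discrete
    Cauchy formula. *)
Lemma coef_le_sup p (M : R) j : (forall t, normc p.[expi t] <= M) -> normc p`_j <= M.
Proof.
move=> HM; pose N := (size p + j).+1.
have Np : 0 < N%:R :> R by rewrite ltr0n.
have E : \sum_(l < N) p.[expi (node R N l)] * expi (- (j%:R * node R N l)) = N%:R%:C * p`_j.
  under eq_bigr do rewrite horner_coef mulr_suml.
  rewrite exchange_big /=.
  have one (i : nat) : (i < size p)%N ->
     \sum_(l < N) p`_i * expi (node R N l) ^+ i * expi (- (j%:R * node R N l)) =
     if i == j then N%:R%:C * p`_i else 0.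
    move=> ip; under eq_bigr do rewrite -mulrA expiX -expiD.
    rewrite -mulr_sumr; have [ij|ij|->] := ltngtP i j.
    - rewrite (eq_bigr (fun l : 'I_N => conjc (expi ((j - i)%:R * node R N l + 0)))); last first.
        move=> l _; rewrite /expi /= addr0 natrB 1?ltnW// -cosN -sinN.
        by congr (cos _ +i* sin _); ring.
      rewrite -(rmorph_sum (@conjc R)) node_sum_expi ?rmorph0 ?mulr0//.
      by rewrite subn_gt0 ij (leq_ltn_trans (leq_subr _ _))// /N ltnS leq_addl.
    - rewrite (eq_bigr (fun l : 'I_N => expi ((i - j)%:R * node R N l + 0))); last first.
        by move=> l _; congr expi; rewrite natrB 1?ltnW//; ring.
      rewrite node_sum_expi ?mulr0// subn_gt0 ij (leq_ltn_trans (leq_subr _ _))//.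
      by rewrite /N ltnS (leq_trans (ltnW ip))// leq_addr.
    - rewrite (eq_bigr (fun=> 1)); last by move=> l _; rewrite subrr expi0.
      by rewrite sumr_const card_ord mulrC rmorph_nat.
  rewrite (eq_bigr (fun i : 'I_(size p) =>
    if (i : nat) == j then N%:R%:C * p`_i else 0)); last first.
    by move=> i _; exact: one.
  rewrite -big_mkcond /=.
  have [jp|pj] := ltnP j (size p).
    by rewrite (big_pred1 (Ordinal jp)).
  rewrite nth_default// mulr0 big1// => i /eqP ij.
  by have := ltn_ord i; rewrite ij ltnNge pj.
have : normc (N%:R%:C * p`_j) <= N%:R * M.
  rewrite -E; apply: (le_trans (normc_sum _)).
  apply: (@le_trans _ _ (\sum_(l < N) M)); last by rewrite sumr_const card_ord mulr_natl.
  by apply: ler_sum => l _; rewrite ComplexField.Normc.normcM normc_expi mulr1.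
by rewrite ComplexField.Normc.normcM normc_real ger0_norm// ler_pM2l.
Qed.

Lemma pow_bounded_le1 (y C : R) : 0 <= y -> (forall q, y ^+ q <= C) -> y <= 1.
Proof.
move=> y0 H; rewrite leNgt; apply/negP => y1.
have B q : 1 + q%:R * (y - 1) <= y ^+ q.
  elim: q => [|q IH]; first by rewrite mul0r addr0 expr0.
  have q0 : 0 <= q%:R :> R by [].
  rewrite exprS -natr1.
  have := ler_wpM2l y0 IH; have := mulr_ge0 q0 (sqr_ge0 (y - 1)); lra.
have h0 : 0 < y - 1 by rewrite subr_gt0.
have [q Hq] : exists q : nat, C / (y - 1) < q%:R.
  by exists (Num.truncn (C / (y - 1))).+1; exact: truncnS_gt.
have := le_trans (B q) (H q); rewrite leNgt => /negP; apply.
by move: Hq; rewrite ltr_pdivrMr// => Hq; lra.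
Qed.

(** The coefficient estimate only gives |p| <= M / (1 - r); applied to all powers
    p^q it gives (|p| / M)^q <= 1 / (1 - r) for every q, hence |p| <= M. *)
Lemma max_modulus p (M r t : R) : 0 < M -> (forall t, normc p.[expi t] <= M) ->
  0 <= r < 1 -> normc p.[r%:C * expi t] <= M.
Proof.
move=> M0 HM /andP[r0 r1].
have B p' M' : (forall t, normc p'.[expi t] <= M') -> normc p'.[r%:C * expi t] <= M' / (1 - r).
  move=> HM'.
  have M'0 : 0 <= M' by apply: le_trans (HM' 0); exact: normc_ge0.
  rewrite horner_coef; apply: (le_trans (normc_sum _)).
  apply: (@le_trans _ _ (\sum_(i < size p') M' * r ^+ i)).
    apply: ler_sum => i _.
    rewrite ComplexField.Normc.normcM normcX ComplexField.Normc.normcM normc_expi mulr1.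
    rewrite normc_real ger0_norm// ler_wpM2r ?exprn_ge0//; exact: coef_le_sup.
  rewrite -mulr_sumr ler_wpM2l// -[leRHS]mul1r ler_pdivlMr ?subr_gt0//.
  by rewrite mulrC -opprB mulNr -subrX1 opprB gerBl exprn_ge0.
rewrite -[leRHS]mul1r -ler_pdivrMr//.
apply: (@pow_bounded_le1 _ (1 - r)^-1); first by rewrite divr_ge0 ?normc_ge0// ltW.
move=> q; rewrite expr_div_n ler_pdivrMr ?exprn_gt0// (mulrC (1 - r)^-1) -normcX -horner_exp.
apply: B => s; rewrite horner_exp normcX lerXn2r// nnegrE ?normc_ge0//; exact: ltW.
Qed.

Lemma normc_1sub r s : normc (1 - r%:C * expi s) ^+ 2 = Delta r s.
Proof.
rewrite sqr_normc /= /Delta !mul0r !subr0 addr0 sub0r sqrrN exprMn.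
have := cos2Dsin2 s => cz.
have -> : sin s ^+ 2 = 1 - cos s ^+ 2 by rewrite -cz; ring.
ring.
Qed.

(** The maximum principle for the product of the 1 - z e^(-ix). *)
Lemma prod_Delta_le (th : seq R) (M : R) : 0 < M ->
  (forall t, \prod_(x <- th) Delta 1 (t - x) <= M ^+ 2) ->
  forall r t, 0 <= r < 1 -> \prod_(x <- th) Delta r (t - x) <= M ^+ 2.
Proof.
move=> M0 HM r t r01.
pose p : {poly R[i]} := \prod_(x <- th) (1 - (expi (- x))%:P * 'X).
have pE u s : p.[u%:C * expi s] = \prod_(x <- th) (1 - u%:C * expi (s - x)).
  rewrite horner_prod; apply: eq_bigr => x _.
  rewrite hornerD hornerN hornerM !hornerC hornerX expiD.
  by rewrite mulrCA (mulrC (expi (- x))).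
have pD u s : normc p.[u%:C * expi s] ^+ 2 = \prod_(x <- th) Delta u (s - x).
  rewrite pE normc_prod -prodrXl; apply: eq_bigr => x _; exact: normc_1sub.
rewrite -pD ler_sqr ?nnegrE ?normc_ge0 ?(ltW M0)//.
apply: max_modulus => // s.
have := pD 1 s; rewrite mul1r => e.
by rewrite -ler_sqr ?nnegrE ?normc_ge0 ?(ltW M0)// e.
Qed.

Lemma sum_ln_Delta_le (th : seq R) (M : R) : 0 < M ->
  (forall t, \prod_(x <- th) Delta 1 (t - x) <= M ^+ 2) ->
  forall r t, 0 <= r < 1 -> \sum_(x <- th) ln (Delta r (t - x)) <= 2 * ln M.
Proof.
move=> M0 HM r t r01.
have -> : \sum_(x <- th) ln (Delta r (t - x)) = ln (\prod_(x <- th) Delta r (t - x)).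
  have [] : 0 < \prod_(x <- th) Delta r (t - x) /\
    \sum_(x <- th) ln (Delta r (t - x)) = ln (\prod_(x <- th) Delta r (t - x)); last by [].
  elim: (th) => [|x s [IH1 IH2]]; first by rewrite !big_nil ln1.
  rewrite !big_cons mulr_gt0 ?Delta_gt0//; split => //.
  by rewrite lnM ?posrE ?Delta_gt0// IH2.
have -> : 2 * ln M = ln (M ^+ 2) by rewrite lnXn// mulr_natl.
rewrite ler_ln ?posrE ?exprn_gt0 ?prodr_gt0// ?prod_Delta_le//.
by move=> x _; apply: Delta_gt0.
Qed.
End Complex.

(** * Zeros of a polynomial in an arc *)

Section ArcCount.
Local Open Scope complex_scope.
Variable R : realType.
Implicit Types (s t x r d : R) (z w : R[i]) (p : {poly R[i]}).

Definition mod2pi x : R := if 0 <= x then x else x + 2 * pi.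

Lemma cos_mod2pi t x : cos (t - mod2pi x) = cos (t - x).
Proof.
rewrite /mod2pi; case: ifP => // _.
by rewrite -[LHS](@cosD2npi R 1); congr cos; ring.
Qed.

Lemma mod2pi_itv x : - (2 * pi) < x < 2 * pi -> 0 <= mod2pi x <= 2 * pi.
Proof.
rewrite /mod2pi => /andP[x1 x2]; case: ifPn => [->|]; first by rewrite ltW.
by rewrite -ltNge => x0; apply/andP; split; lra.
Qed.

(** The values at x - a and at b - x, reduced modulo 2 pi, of the sawtooth
    (pi - t) / (2 pi) add up to the indicator of [a, b]
    minus (b - a) / (2 pi), and both families of shifted or reflected angles
    satisfy the hypothesis on the logarithms. *)
Lemma count_arc_le (th : seq R) (L d a b : R) : 0 <= L -> 0 < d < 1 ->
  0 <= a -> a <= b -> b < 2 * pi ->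
  (forall x, x \in th -> 0 <= x < 2 * pi) ->
  (forall r t, 0 <= r < 1 -> \sum_(x <- th) ln (Delta r (t - x)) <= 2 * L) ->
  (count (fun x => a <= x <= b) th)%:R <=
  (size th)%:R * (b - a) / (2 * pi) + (size th)%:R * d + 16 * L / (pi ^+ 2 * d).
Proof.
move=> L0 d01 a0 ab b2 Hth HL.
have p0 := @pi_gt0 R.
pose th1 := [seq mod2pi (x - a) | x <- th].
pose th2 := [seq mod2pi (b - x) | x <- th].
have H1 x : x \in th1 -> 0 <= x <= 2 * pi.
  by move=> /mapP[y /Hth /andP[y0 y1] ->]; apply: mod2pi_itv; apply/andP; split; lra.
have H2 x : x \in th2 -> 0 <= x <= 2 * pi.
  by move=> /mapP[y /Hth /andP[y0 y1] ->]; apply: mod2pi_itv; apply/andP; split; lra.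
have HL1 r t : 0 <= r < 1 -> \sum_(x <- th1) ln (Delta r (t - x)) <= 2 * L.
  move=> r01; rewrite big_map; apply: le_trans (HL r (t + a) r01).
  rewrite le_eqVlt; apply/orP; left; apply/eqP; apply: eq_bigr => x _.
  by rewrite /Delta cos_mod2pi; congr (ln (1 - _ * cos _ + _)); ring.
have HL2 r t : 0 <= r < 1 -> \sum_(x <- th2) ln (Delta r (t - x)) <= 2 * L.
  move=> r01; rewrite big_map; apply: le_trans (HL r (b - t) r01).
  rewrite le_eqVlt; apply/orP; left; apply/eqP; apply: eq_bigr => x _.
  by rewrite /Delta cos_mod2pi -cosN; congr (ln (1 - _ * cos _ + _)); ring.
have := sawtooth_sum_le L0 d01 H1 HL1; have := sawtooth_sum_le L0 d01 H2 HL2.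
rewrite !size_map !big_map.
have key : (count (fun x => a <= x <= b) th)%:R =
  \sum_(x <- th) (pi - mod2pi (x - a)) / (2 * pi) + \sum_(x <- th) (pi - mod2pi (b - x)) / (2 * pi)
  + (size th)%:R * (b - a) / (2 * pi).
  rewrite -big_split /=.
  elim: th Hth {HL th1 th2 H1 H2 HL1 HL2} => [|x s IH] Hs.
    by rewrite big_nil !mul0r addr0.
  rewrite big_cons /= natrD IH; last by move=> y ys; apply: Hs; rewrite in_cons ys orbT.
  have /andP[x0 x2] : 0 <= x < 2 * pi by apply: Hs; rewrite mem_head.
  rewrite -[(size s).+1%:R]natr1; move: (\sum_(_ <- _) _) (size s)%:R => S N.
  have -> : (a <= x <= b)%R%:R = (pi - mod2pi (x - a)) / (2 * pi) +
      (pi - mod2pi (b - x)) / (2 * pi) + (b - a) / (2 * pi) :> R.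
    have pn := lt0r_neq0 p0; rewrite /mod2pi !subr_ge0.
    have [ax|xa] := leP a x; have [xb|bx] := leP x b => /=.
    - by move: (pi : R) pn => q qn; field.
    - by move: (pi : R) pn => q qn; field.
    - by move: (pi : R) pn => q qn; field.
    - by have := lt_trans bx xa; rewrite ltNge ab.
  by ring.
rewrite key.
have -> : 16 * L / (pi ^+ 2 * d) = 8 * L / (pi ^+ 2 * d) + 8 * L / (pi ^+ 2 * d) by ring.
by lra.
Qed.

(** At z = 0 every angle works; otherwise acos of the normalised real part, or
    2 pi minus it, according to the sign of the imaginary part. *)
Lemma polar z : exists t, 0 <= t < 2 * pi /\ z = (normc z)%:C * expi t.
Proof.
have p0 := @pi_gt0 R.
have [->|z0] := eqVneq z 0.
  exists 0; rewrite lexx mulr_gt0//; split => //.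
  by rewrite ComplexField.Normc.normc0 mul0r.
have n0 := normc_gt0 z0; have nn := lt0r_neq0 n0.
have := sqr_normc z; case: z z0 n0 nn => x y z0; set n := normc _ => n0 nn /= E.
pose c := x / n; pose u := y / n.
have cu : c ^+ 2 + u ^+ 2 = 1.
  by rewrite /c /u !expr_div_n -mulrDl -E divff// expf_neq0.
have c1 : -1 <= c <= 1.
  rewrite -ler_norml -(@ler_pXn2r _ 2)// ?nnegrE// real_normK ?num_real// expr1n.
  by have := sqr_ge0 u; lra.
have sa : sin (acos c) = `|u|.
  by rewrite sin_acos//; have -> : 1 - c ^+ 2 = u ^+ 2 by [lra]; rewrite sqrtr_sqr.
have ca : cos (acos c) = c by rewrite acosK.
have xe : x = n * c by rewrite /c mulrC divfK.
have ye : y = n * u by rewrite /u mulrC divfK.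
have Cx s v : n%:C * (s +i* v) = (n * s) +i* (n * v).
  by apply/eqP; rewrite eq_complex /= !mul0r subr0 addr0 !eqxx.
have [u0|u0] := leP 0 u.
  exists (acos c); split.
    by rewrite acos_ge0//= (le_lt_trans (acos_lepi c1))//; lra.
  by rewrite /expi ca sa ger0_norm// Cx -xe -ye.
exists (2 * pi - acos c); split.
  rewrite subr_ge0 (le_trans (acos_lepi c1)) /=; last by lra.
  rewrite ltrBlDr ltrDl acos_gt0//.
  case/andP: c1 => -> /= c1; rewrite lt_neqAle c1 andbT; apply/eqP => ce.
  by move: cu; rewrite ce expr1n => /eqP; rewrite -subr_eq0 addrC addKr sqrf_eq0 (lt_eqF u0).
rewrite /expi.
have -> : cos (2 * pi - acos c) = c.
  have -> : 2 * pi - acos c = - acos c + 1%:R * (2 * pi) by ring.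
  by rewrite cosD2npi cosN ca.
have -> : sin (2 * pi - acos c) = u.
  have -> : 2 * pi - acos c = - acos c + 1%:R * (2 * pi) by ring.
  by rewrite sinD2npi sinN sa ltr0_norm// opprK.
by rewrite Cx -xe -ye.
Qed.

Lemma expi_inj s t : 0 <= s < 2 * pi -> 0 <= t < 2 * pi -> expi s = expi t -> s = t.
Proof.
wlog st : s t / s <= t.
  move=> H hs ht e; have [/H|/ltW/H] := leP s t; first exact.
  by move=> h; apply/esym/h.
move=> /andP[s0 s2] /andP[t0 t2] [ec es].
have c1 : cos (t - s) = 1 by rewrite cosB -ec -es -!expr2 cos2Dsin2.
apply/eqP; rewrite eq_le st /= leNgt; apply/negP => lt_st.
have h : 0 < sin ((t - s) / 2) by apply: sin_gt0_pi; apply/andP; split; lra.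
have : cos ((t - s) / 2 + (t - s) / 2) = cos (t - s) by congr cos; field.
rewrite c1 cosD; have := cos2Dsin2 ((t - s) / 2); nra.
Qed.

Lemma normc_opp z : normc (- z) = normc z.
Proof.
case: z => u v; have -> : - (u +i* v) = (- u) +i* (- v) by [].
by rewrite /= !sqrrN.
Qed.

Lemma sum_count_mem (T : eqType) (s rs : seq T) : uniq s ->
  (\sum_(t <- s) count_mem t rs)%N = count (mem s) rs.
Proof.
move=> us; elim: rs => [|z rs IH] /=; first by rewrite big1.
rewrite big_split /= IH; congr addn.
elim: s us {IH} => [|y s IHs] /=; first by rewrite big_nil.
move=> /andP[ys us]; rewrite big_cons IHs// in_cons.
by have [->|//] := eqVneq z y; rewrite (negPf ys).
Qed.

Lemma mup_count z (rs : seq R[i]) (c : R[i]) : c != 0 ->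
  mup z (c *: \prod_(w <- rs) ('X - w%:P)) = count_mem z rs.
Proof.
move=> c0; rewrite -mul_polyC mupMr ?rootC//.
elim: rs => [|w rs IH]; first by rewrite big_nil mupNroot// root1.
rewrite big_cons mupM ?polyXsubC_eq0//; last first.
  by rewrite monic_neq0// monic_prod_XsubC.
rewrite IH /= -[X in mup _ X]expr1 mup_XsubCX; by case: eqP.
Qed.

(** For a root z of modulus a and angle x, |e^(it) - z|^2 >= a |e^(it) - e^(ix)|^2,
    since the difference is (1 - a)^2; the product of the a times the modulus
    of the leading coefficient is |p(0)|.  So the hypothesis on the extreme
    coefficients says that the radial projection of the roots does not increase
    the maximum on the circle. *)
Theorem poly_arc_mult_le p (M d a b : R) (ts : seq R) :
  1 <= normc p.[0] * normc (lead_coef p) -> 1 <= M ->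
  (forall t, normc p.[expi t] <= M) -> 0 < d < 1 ->
  0 <= a -> a <= b -> b < 2 * pi -> uniq ts -> (forall t, t \in ts -> a <= t <= b) ->
  (\sum_(t <- ts) mup (expi t) p)%:R <=
  (size p).-1%:R * (b - a) / (2 * pi) + (size p).-1%:R * d + 16 * ln M / (pi ^+ 2 * d).
Proof.
move=> H1 M1 HM d01 a0 ab b2 uts Hts.
have [rs prs] := closed_field_poly_normal p.
set lc := lead_coef p in prs H1.
have lc0 : lc != 0.
  apply: contraTneq H1 => ->; rewrite ComplexField.Normc.normc0 mulr0.
  by rewrite -ltNge ltr01.
have szp : (size p).-1 = size rs.
  by rewrite prs size_scale// size_prod_XsubC.
have p00 : p.[0] = lc * \prod_(z <- rs) (- z).
  rewrite prs hornerZ horner_prod; congr (_ * _).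
  by apply: eq_bigr => z _; rewrite hornerXsubC sub0r.
have [arg Harg] := choice polar.
pose th := map arg rs.
have Hth x : x \in th -> 0 <= x < 2 * pi by move=> /mapP[z _ ->]; have [] := Harg z.
have M0 : 0 < M by apply: lt_le_trans M1.
have HD t : \prod_(x <- th) Delta 1 (t - x) <= M ^+ 2.
  apply: (@le_trans _ _ (normc p.[expi t] ^+ 2)); last first.
    by rewrite lerXn2r// nnegrE ?normc_ge0// ltW.
  have -> : normc p.[expi t] ^+ 2 = normc lc ^+ 2 * \prod_(z <- rs) normc (expi t - z) ^+ 2.
    rewrite {1}prs hornerZ horner_prod ComplexField.Normc.normcM exprMn normc_prod -prodrXl.
    by congr (_ * _); apply: eq_bigr => z _; rewrite hornerXsubC.
  apply: (@le_trans _ _ (normc lc ^+ 2 * \prod_(z <- rs) (normc z * Delta 1 (t - arg z)))).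
    rewrite big_split /= mulrA.
    have -> : normc lc ^+ 2 * \prod_(z <- rs) normc z = normc p.[0] * normc lc.
      rewrite p00 ComplexField.Normc.normcM normc_prod expr2.
      have -> : \prod_(z <- rs) normc (- z) = \prod_(z <- rs) normc z.
        by apply: eq_bigr => z _; exact: normc_opp.
      by ring.
    rewrite /th big_map ler_peMl// prodr_ge0// => z _.
    by apply: le_trans (Delta_ge _ _) => //; rewrite sqr_ge0.
  rewrite ler_wpM2l ?sqr_ge0//; apply: ler_prod => z _.
  have D0 : 0 <= Delta 1 (t - arg z).
    by apply: le_trans (Delta_ge _ _) => //; rewrite sqr_ge0.
  rewrite mulr_ge0 ?normc_ge0//=.
  have [_ ze] := Harg z; rewrite [in leRHS]ze.
  move: (normc z) (normc_ge0 z) (arg z) => n n0 x.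
  rewrite sqr_normc /= !mul0r subr0 addr0 /Delta cosB.
  have := cos2Dsin2 t; have := cos2Dsin2 x.
  move: (cos t) (sin t) (cos x) (sin x) => c s c' s' e1 e2.
  have -> : (c - n * c') ^+ 2 + (s - n * s') ^+ 2 =
    (c ^+ 2 + s ^+ 2) + n ^+ 2 * (c' ^+ 2 + s' ^+ 2) - 2 * n * (c * c' + s * s') by ring.
  by rewrite e1 e2; have := sqr_ge0 (1 - n); lra.
have HL := sum_ln_Delta_le M0 HD.
have L0 : 0 <= ln M by rewrite ln_ge0.
have := count_arc_le L0 d01 a0 ab b2 Hth HL.
rewrite szp /th size_map count_map; apply: le_trans.
rewrite ler_nat {1}prs.
rewrite (eq_bigr (fun t => count_mem (expi t) rs)); last by move=> t _; rewrite mup_count.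
have itv t : t \in ts -> 0 <= t < 2 * pi.
  by move=> /Hts /andP[h1 h2]; apply/andP; split; lra.
have ums : uniq (map (@expi R) ts).
  rewrite map_inj_in_uniq// => x y /itv hx /itv hy; exact: expi_inj.
rewrite -(big_map (@expi R) xpredT (fun z => count_mem z rs)) sum_count_mem//.
apply: sub_count => z /= /mapP[t tts zt].
have [hz ze] := Harg z.
have -> : arg z = t; last exact: Hts.
apply: expi_inj => //; first exact: itv.
by rewrite -zt [in RHS]ze zt normc_expi mul1r.
Qed.
End ArcCount.

(** * Orders of vanishing *)

Section Multiplicity.
Local Open Scope complex_scope.
Variable R : realType.
Implicit Types (s t x r d w : R) (z : R[i]) (p q : {poly R[i]}).

Definition twist (c : nat) p t : R[i] := expi (- (c%:R * t)) * p.[expi t].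

(** The operator on polynomials which corresponds to d/dt on e^(-ict) p(e^(it)). *)
Definition twist_deriv (c : nat) p : {poly R[i]} := 'i%C *: ('X * p^`() - c%:R *: p).

Lemma twistE c p t S : (size p <= S)%N ->
  twist c p t = \sum_(0 <= j < S) p`_j * expi ((j%:R - c%:R) * t).
Proof.
move=> pS; rewrite /twist (horner_coef_wide _ pS) mulr_sumr big_mkord.
apply: eq_bigr => j _; rewrite expiX mulrCA -expiD; congr (_ * expi _); ring.
Qed.

Lemma coef_twist_deriv c p j : (twist_deriv c p)`_j = 'i%C * (j%:R - c%:R) * p`_j.
Proof.
rewrite /twist_deriv coefZ coefB coefZ coefXM coef_deriv -mulrA mulrBl; congr (_ * (_ - _)).
by case: j => [|j] /=; [rewrite mul0r | rewrite mulr_natl].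
Qed.

Lemma size_twist_deriv c p : (size (twist_deriv c p) <= size p)%N.
Proof. by apply/leq_sizeP => j pj; rewrite coef_twist_deriv nth_default// mulr0. Qed.

Lemma is_derive_Re_expi (a : R[i]) w t :
  is_derive t (1 : R) (fun t => complex.Re (a * expi (w * t)))
    (complex.Re ('i%C * w%:C * a * expi (w * t))).
Proof.
case: a => u v.
have -> : (fun t => complex.Re ((u +i* v) * expi (w * t))) =
  (fun t => u * cos (w * t) - v * sin (w * t)) by [].
have d1 : is_derive t (1 : R) (fun t => w * t) w.
  by apply: is_derive_eq; rewrite /GRing.scale /= mulr1 ?mulr0 ?add0r ?addr0.
have d2 := @is_derive1_comp _ (@sin R) _ t _ _ (is_derive_sin _) d1.
have d3 := @is_derive1_comp _ (@cos R) _ t _ _ (is_derive_cos _) d1.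
apply: (is_derive_eq (is_deriveB (is_deriveZ u d3) (is_deriveZ v d2))).
by rewrite /GRing.scale /=; ring.
Qed.

Lemma Re_mulNi (a : R[i]) : complex.Re (- 'i%C * a) = complex.Im a.
Proof. by case: a => u v /=; ring. Qed.

(** Term by term: the j-th term of the expansion of [twist] is an exponential of
    frequency j - c. *)
Lemma is_derive_Re_twist c p t :
  is_derive t (1 : R) (fun t => complex.Re (twist c p t))
    (complex.Re (twist c (twist_deriv c p) t)).
Proof.
have -> : (fun t => complex.Re (twist c p t)) =
   (fun t => \sum_(0 <= j < size p) complex.Re (p`_j * expi ((j%:R - c%:R) * t))).
  by apply/funext => x; rewrite (twistE _ _ (leqnn _)) !big_mkord Re_sum.
rewrite (twistE _ _ (size_twist_deriv c p)) big_mkord Re_sum -(big_mkord xpredT (fun j =>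
  complex.Re ((twist_deriv c p)`_j * expi ((j%:R - c%:R) * t)))).
apply: (@is_derive_bigsum R (fun j t => complex.Re (p`_j * expi ((j%:R - c%:R) * t)))) => j _.
apply: (is_derive_eq (is_derive_Re_expi p`_j (j%:R - c%:R) t)).
by rewrite coef_twist_deriv rmorphB !rmorph_nat.
Qed.

Lemma twistZ c (a : R[i]) p t : twist c (a *: p) t = a * twist c p t.
Proof. by rewrite /twist hornerZ mulrCA. Qed.

(** The imaginary part is the real part for the multiple - i p of p, so its
    derivative is known from [is_derive_Re_twist]. *)
Lemma twist_deriv_real c p : (forall t, complex.Im (twist c p t) = 0) ->
  forall t, complex.Im (twist c (twist_deriv c p) t) = 0.
Proof.
move=> H t.
have E : twist_deriv c ((- 'i%C) *: p) = (- 'i%C) *: twist_deriv c p.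
  by apply/polyP => j; rewrite !(coefZ, coef_twist_deriv); ring.
have := is_derive_Re_twist c ((- 'i%C) *: p) t.
rewrite E twistZ Re_mulNi.
have -> : (fun t => complex.Re (twist c (- 'i%C *: p) t)) = cst 0.
  by apply/funext => x; rewrite twistZ Re_mulNi H.
move=> d1; have := is_derive_cst (0 : R) t (1 : R) => d2.
by rewrite -(@derive_val _ _ _ _ _ _ _ d1) (@derive_val _ _ _ _ _ _ _ d2).
Qed.

Lemma derive1n_twist c p m :
  derive1n m (fun t => complex.Re (twist c p t)) =
  (fun t => complex.Re (twist c (iter m (twist_deriv c) p) t)).
Proof.
elim: m => [|m IH]; first by rewrite derive1n0.
rewrite derive1nS IH; apply/funext => t; rewrite derive1E /=.
by have d1 := is_derive_Re_twist c (iter m (twist_deriv c) p) t; rewrite derive_val.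
Qed.

(** Away from 0, X d/dX lowers the multiplicity of a root by exactly one, and the
    term c p does not interfere because it vanishes to a higher order. *)
Lemma iter_twist_deriv_neq0 c z m p q : z != 0 -> p = ('X - z%:P) ^+ m * q -> q.[z] != 0 ->
  exists2 k, (k <= m)%N & (iter k (twist_deriv c) p).[z] != 0.
Proof.
move=> z0; elim: m p q => [|m IH] p q pE qz.
  by exists 0%N => //=; rewrite pE expr0 mul1r.
pose q2 := 'i%C *: (m.+1%:R *: ('X * q) + ('X - z%:P) * ('X * q^`() - c%:R *: q)).
have E : twist_deriv c p = ('X - z%:P) ^+ m * q2.
  rewrite /twist_deriv /q2 pE derivM deriv_exp derivXsubC mul1r -scalerAr; congr (_ *: _).
  rewrite -mulr_natl -!mul_polyC !exprS /= !polyC_natr; ring.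
have q2z : q2.[z] != 0.
  rewrite /q2 hornerZ hornerD hornerZ hornerM hornerX hornerM hornerXsubC subrr mul0r addr0.
  rewrite !mulf_neq0// ?pnatr_eq0//.
  by rewrite eq_complex /= oner_eq0 andbF.
have [k km kz] := IH _ _ E q2z.
by exists k.+1 => //; rewrite iterSr.
Qed.

Lemma zero_mult_le (f : R -> R) c p t : p != 0 -> (forall t, twist c p t = (f t)%:C) ->
  (zero_mult f t <= (mup (expi t) p)%:R%:E)%E.
Proof.
move=> p0 Hf.
have fE : f = fun t => complex.Re (twist c p t) by apply/funext => x; rewrite Hf.
have [m [q qz pE]] := multiplicity_XsubC p (expi t).
rewrite p0 /= in qz.
have mm : mup (expi t) p = m.
  rewrite pE mulrC mupMl// mup_XsubCX eqxx //.
have [k km kz] := @iter_twist_deriv_neq0 c (expi t) m p q (expi_neq0 t) (etrans pE (mulrC _ _)) qz.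
rewrite mm; apply: (@le_trans _ _ k%:R%:E); last by rewrite lee_fin ler_nat.
apply: ereal_inf_lbound; exists k => //=.
rewrite fE derive1n_twist.
have im0 n : forall t, complex.Im (twist c (iter n (twist_deriv c) p) t) = 0.
  by elim: n => [x|n IHn] /=; [rewrite Hf | exact: twist_deriv_real].
apply: contra kz => /eqP re0.
have : twist c (iter k (twist_deriv c) p) t == 0.
  by rewrite eq_complex re0 im0 /= !eqxx.
by rewrite /twist mulf_eq0 (negPf (expi_neq0 _)).
Qed.

(** Every finite partial sum of the [esum] is estimated by [poly_arc_mult_le]. *)
Theorem zero_count_le (f : R -> R) c p (M d a b : R) :
  (forall t, twist c p t = (f t)%:C) ->
  1 <= normc p.[0] * normc (lead_coef p) -> 1 <= M ->
  (forall t, `|f t| <= M) -> 0 < d < 1 ->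
  0 <= a -> a <= b -> b < 2 * pi ->
  (zero_count `[a, b]%classic f <=
   ((size p).-1%:R * (b - a) / (2 * pi) + (size p).-1%:R * d + 16 * ln M / (pi ^+ 2 * d))%:E)%E.
Proof.
move=> Hf H1 M1 HM d01 a0 ab b2.
have p0 : p != 0.
  by apply: contraTneq H1 => ->; rewrite horner0 ComplexField.Normc.normc0 mul0r -ltNge ltr01.
have HM' t : normc p.[expi t] <= M.
  have := HM t; rewrite -normc_real -Hf /twist ComplexField.Normc.normcM normc_expi mul1r.
  exact.
apply: ge_ereal_sup => _ [A [finA AI] <-].
rewrite fsbig_finite//=.
have Hts t : t \in finmap.enum_fset (fset_set A) -> a <= t <= b.
  move=> h; have : t \in fset_set A by [].
  by rewrite in_fset_set// => /set_mem /AI /=; rewrite in_itv.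
have uA : uniq (finmap.enum_fset (fset_set A)) by exact: finmap.fset_uniq.
have := poly_arc_mult_le H1 M1 HM' d01 a0 ab b2 uA Hts.
rewrite -lee_fin; apply: le_trans.
rewrite natr_sum -sumEFin; apply: lee_sum => t _.
exact: (zero_mult_le t p0 Hf).
Qed.
End Multiplicity.

(** * Rudin-Shapiro polynomials: the upper bound *)

Section RudinShapiroZeros.
Local Open Scope complex_scope.
Variable R : realType.
Implicit Types (s t x r d w : R) (z : R[i]) (p q : {poly R[i]}).

Lemma rudin_shapiroS k : rudin_shapiro R k.+1 =
  (RSP R k + 'X^(2 ^ k) * RSQ R k, RSP R k - 'X^(2 ^ k) * RSQ R k).
Proof. by rewrite /RSP /RSQ /=; case: (rudin_shapiro R k). Qed.

Lemma RSPS k : RSP R k.+1 = RSP R k + 'X^(2 ^ k) * RSQ R k.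
Proof. by rewrite {1}/RSP rudin_shapiroS. Qed.

Lemma RSQS k : RSQ R k.+1 = RSP R k - 'X^(2 ^ k) * RSQ R k.
Proof. by rewrite {1}/RSQ rudin_shapiroS. Qed.

(** The polynomials z^(n-1) P_k(1/z) and z^(n-1) Q_k(1/z), n = 2^k, through their
    own recursion. *)
Fixpoint rev_shapiro (k : nat) : {poly R[i]} * {poly R[i]} :=
  if k is k'.+1 then
    ('X^(2 ^ k') * (rev_shapiro k').1 + (rev_shapiro k').2,
     'X^(2 ^ k') * (rev_shapiro k').1 - (rev_shapiro k').2)
  else (1, 1).

Lemma conjc_expi t : conjc (expi t) = expi (- t).
Proof. by rewrite /expi /= cosN sinN. Qed.

(** The coefficients being real, P_k(1/z) is the conjugate of P_k(z) on the circle. *)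
Lemma rev_shapiroE k t :
  (rev_shapiro k).1.[expi t] = expi ((2 ^ k)%:R * t - t) * conjc (RSP R k).[expi t] /\
  (rev_shapiro k).2.[expi t] = expi ((2 ^ k)%:R * t - t) * conjc (RSQ R k).[expi t].
Proof.
elim: k => [|k [IH1 IH2]].
  by rewrite /RSP /RSQ /= !hornerC conjc1 mulr1 expn0 mul1r subrr expi0.
rewrite RSPS RSQS /= !hornerD !hornerN !hornerM !hornerXn IH1 IH2 !expiX.
have cD u v : conjc (u + v) = conjc u + conjc v :> R[i] by exact: rmorphD.
have cN u : conjc (- u) = - conjc u :> R[i] by exact: rmorphN.
have cM u v : conjc (u * v) = conjc u * conjc v :> R[i] by exact: rmorphM.
rewrite !cD !cN !cM conjc_expi.
have e1 : expi ((2 ^ k.+1)%:R * t - t) = expi ((2 ^ k)%:R * t) * expi ((2 ^ k)%:R * t - t).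
  by rewrite -expiD expnS natrM; congr expi; ring.
have e2 : expi ((2 ^ k)%:R * t) * expi (- ((2 ^ k)%:R * t)) = 1 by rewrite -expiD subrr expi0.
rewrite e1.
move: (expi _) (expi (- _)) (expi (_ - t)) e2 (conjc _) (conjc _) => a b c e2 v u.
have h (x : R[i]) : a * c * (u + x * (b * v)) = a * (c * u) + x * (c * v).
  by transitivity (a * (c * u) + x * ((a * b) * (c * v))); [ring | rewrite e2 mul1r].
split; first by have := h 1; rewrite !mul1r => ->.
by have := h (-1); rewrite !mulN1r => ->.
Qed.

(** The parallelogram law, at each step of the recursion. *)
Lemma sqmod_sum k t :
  normc (RSP R k).[expi t] ^+ 2 + normc (RSQ R k).[expi t] ^+ 2 = 2 * (2 ^ k)%:R.
Proof.
have par (u v : R[i]) : normc (u + v) ^+ 2 + normc (u - v) ^+ 2 = 2 * (normc u ^+ 2 + normc v ^+ 2).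
  by rewrite !sqr_normc; case: u => a b; case: v => c d /=; ring.
elim: k => [|k IH].
  by rewrite /RSP /RSQ /= !hornerC ComplexField.Normc.normc1 expr1n mulr1.
rewrite RSPS RSQS !hornerD hornerN !hornerM hornerXn par.
by rewrite ComplexField.Normc.normcM normcX normc_expi expr1n mul1r IH expnS natrM.
Qed.

Definition unimodular_ends n p :=
  [/\ size p = n, normc p.[0] = 1 & normc (lead_coef p) = 1].

Lemma unimodular_ends_neq0 n p : unimodular_ends n p -> p != 0.
Proof.
case=> _ _ h; apply: contra_eq_neq h => ->.
by rewrite lead_coef0 ComplexField.Normc.normc0 eq_sym oner_eq0.
Qed.

Lemma unimodular_endsN n p : unimodular_ends n p -> unimodular_ends n (- p).
Proof. by case=> h1 h2 h3; split; rewrite ?size_polyN ?hornerN ?lead_coefN ?normc_opp. Qed.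

(** Degrees do not overlap: the low half of the sum is p, the high half is q. *)
Lemma unimodular_ends_step n p q : (0 < n)%N ->
  unimodular_ends n p -> unimodular_ends n q ->
  unimodular_ends (n + n) (p + 'X^n * q).
Proof.
move=> n0 Hp Hq; have q0 := unimodular_ends_neq0 Hq; case: Hp Hq => [p1 p2 p3] [q1 q2 q3].
have sXq : size ('X^n * q) = (n + n)%N by rewrite mulrC size_mulXn// q1.
have lt : (size p < size ('X^n * q)%R)%N by rewrite sXq p1 -addn1 leq_add2l.
split.
- by rewrite addrC size_polyDl.
- by rewrite hornerD hornerM hornerXn expr0n (gtn_eqF n0) mul0r addr0.
- by rewrite lead_coefDr// lead_coefM lead_coefXn mul1r.
Qed.

Lemma unimodular_ends_rs k : [/\ unimodular_ends (2 ^ k) (RSP R k),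
  unimodular_ends (2 ^ k) (RSQ R k), unimodular_ends (2 ^ k) (rev_shapiro k).1 &
  unimodular_ends (2 ^ k) (rev_shapiro k).2].
Proof.
have one : unimodular_ends 1 (1 : {poly R[i]}).
  by split; rewrite ?size_poly1 ?hornerC ?lead_coef1 ?ComplexField.Normc.normc1.
elim: k => [|k [H1 H2 H3 H4]]; first by split.
have k0 : (0 < 2 ^ k)%N by rewrite expn_gt0.
rewrite RSPS RSQS /= expnS mul2n -addnn; split.
- exact: unimodular_ends_step.
- by rewrite -mulrN; apply: unimodular_ends_step => //; exact: unimodular_endsN.
- by rewrite addrC; exact: unimodular_ends_step.
- by rewrite addrC; apply: unimodular_ends_step => //; exact: unimodular_endsN.
Qed.

(** On the unit circle z^(n-1) (|p(z)|^2 - n), when p' is z^(n-1)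
    times the conjugate of p there. *)
Definition excess_poly k (p p' : {poly R[i]}) : {poly R[i]} :=
  p * p' - (2 ^ k)%:R *: 'X^((2 ^ k).-1).

Lemma excess_poly_ends k p p' : (0 < k)%N ->
  unimodular_ends (2 ^ k) p -> unimodular_ends (2 ^ k) p' ->
  unimodular_ends (2 * 2 ^ k).-1 (excess_poly k p p').
Proof.
move=> k0 Hp Hp'; have p0 := unimodular_ends_neq0 Hp; have p0' := unimodular_ends_neq0 Hp'.
case: Hp Hp' => [p1 p2 p3] [q1 q2 q3].
have n2 : (2 <= 2 ^ k)%N by rewrite -[X in (X <= _)%N](expn1 2) leq_exp2l.
set n := (2 ^ k)%N in p1 q1 n2 *.
have spp : size (p * p') = (2 * n).-1 by rewrite size_mul// p1 q1 mul2n addnn.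
have sX : (size ((2 ^ k)%:R *: 'X^((2 ^ k).-1) : {poly R[i]}) <= n)%N.
  by rewrite (leq_trans (size_scale_leq _ _))// size_polyXn prednK// ltnW.
have lt : (size ((2 ^ k)%:R *: 'X^((2 ^ k).-1) : {poly R[i]}) < size (p * p')%R)%N.
  rewrite spp (leq_ltn_trans sX)//; case: (n) n2 => [|[|m]]// _.
  by rewrite mul2n -addnn addSn /= addSn ltnS leq_addl.
split.
- by rewrite /excess_poly size_polyDl ?size_polyN.
- rewrite /excess_poly hornerD hornerN hornerZ hornerM hornerXn expr0n.
  have -> : ((2 ^ k).-1 == 0)%N = false by rewrite -subn1 subn_eq0 leqNgt n2.
  by rewrite mulr0 subr0 ComplexField.Normc.normcM p2 q2 mulr1.
- rewrite /excess_poly lead_coefDl ?size_polyN// lead_coefM.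
  by rewrite ComplexField.Normc.normcM p3 q3 mulr1.
Qed.

Lemma twist_excess k p p' t :
  p'.[expi t] = expi ((2 ^ k)%:R * t - t) * conjc p.[expi t] ->
  twist (2 ^ k).-1 (excess_poly k p p') t = (sqmod_circle p t - (2 ^ k)%:R)%:C.
Proof.
move=> E; rewrite /twist /excess_poly hornerD hornerN hornerZ hornerM hornerXn E expiX.
have e : (2 ^ k).-1%:R * t = (2 ^ k)%:R * t - t.
  by rewrite -subn1 natrB ?expn_gt0// mulrBl mul1r.
rewrite e; set b := expi ((2 ^ k)%:R * t - t); set a := expi (- _).
have ab : a * b = 1 by rewrite /a /b -expiD addrC subrr expi0.
have cc : p.[expi t] * conjc p.[expi t] = (sqmod_circle p t)%:C.
  rewrite /sqmod_circle sqr_normc; case: (_.[_]) => u v.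
  by apply/eqP; rewrite eq_complex /=; apply/andP; split; apply/eqP; ring.
rewrite rmorphB /= -cc rmorph_nat.
transitivity ((a * b) * (p.[expi t] * conjc p.[expi t] - (2 ^ k)%:R)); first by ring.
by rewrite ab mul1r.
Qed.

(** The two cases of the theorem: P_k for b = true, Q_k for b = false. *)
Definition RS b k := if b then RSP R k else RSQ R k.
Definition RSrev b k := if b then (rev_shapiro k).1 else (rev_shapiro k).2.
Definition excess b k t : R := sqmod_circle (RS b k) t - (2 ^ k)%:R.

Lemma twist_excessE b k t :
  twist (2 ^ k).-1 (excess_poly k (RS b k) (RSrev b k)) t = (excess b k t)%:C.
Proof.
by apply: twist_excess; case: b; case: (rev_shapiroE k t).
Qed.

Lemma excess_bound b k t : `|excess b k t| <= (2 ^ k)%:R.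
Proof.
rewrite /excess ler_distl; have := sqmod_sum k t.
have := sqr_ge0 (normc (RSP R k).[expi t]); have := sqr_ge0 (normc (RSQ R k).[expi t]).
by rewrite /sqmod_circle; case: b => /= *; apply/andP; split; lra.
Qed.

(** From e^(x/4) > 1 + x/4 and (1 + x/4)^2 >= x. *)
Lemma ln_lt_half (x : R) : 0 < x -> ln x < x / 2.
Proof.
move=> x0.
have h : x < expR (x / 2).
  have -> : x / 2 = x / 4 + x / 4 by field.
  rewrite expRD; have := @expR_gt1Dx R (x / 4).
  have x4 : x / 4 != 0 by rewrite gt_eqF// divr_gt0.
  move=> /(_ x4); have := sqr_ge0 (1 - x / 4); nra.
by rewrite -[ltRHS]expRK ltr_ln ?posrE ?expR_gt0.
Qed.

(** [zero_count_le] with M = n and d = (4 / pi) (ln n / 2n)^(1/2), which equalises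
    the two error terms; the degree 2n - 2 is rounded up to 2n. *)
Theorem excess_zero_count_le b k (n : nat) (al be : R) : (0 < k)%N -> n = (2 ^ k)%N ->
  0 <= al -> al <= be -> be < 2 * pi ->
  (zero_count `[al, be]%classic (excess b k) <=
    (n%:R * (be - al) / pi + 8 / pi * Num.sqrt (2 * n%:R * ln n%:R))%:E)%E.
Proof.
move=> k0 nE a0 ab b2.
have p0 := @pi_gt0 R; have p2 := @pi_ge2 R.
have n2 : (2 <= n)%N by rewrite nE -[X in (X <= _)%N](expn1 2) leq_exp2l.
have nR : 2 <= n%:R :> R by rewrite ler_nat.
have n0 : 0 < n%:R :> R by apply: lt_le_trans nR.
have L0 : 0 < ln (n%:R : R) by rewrite ln_gt0//; lra.
set L := ln n%:R in L0 *.
pose s := Num.sqrt (2 * n%:R * L).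
have ss : s ^+ 2 = 2 * n%:R * L by rewrite sqr_sqrtr// !mulr_ge0// ltW.
have s0 : 0 < s by rewrite sqrtr_gt0 !mulr_gt0.
(* this is (4 / pi) (ln n / 2n)^(1/2) *)
pose d := 4 * s / (pi * (2 * n%:R)).
have pn0 : 0 < pi * (2 * n%:R) :> R by rewrite !mulr_gt0.
have d0 : 0 < d by rewrite divr_gt0// mulr_gt0.
have d1 : d < 1.
  rewrite ltr_pdivrMr// mul1r.
  have Ln := ln_lt_half n0.
  have h : s < n%:R.
    rewrite -ltr_sqr ?nnegrE ?(ltW s0) ?(ltW n0)// ss; rewrite -/L in Ln; nra.
  by nra.
have d01 : 0 < d < 1 by rewrite d0.
have ends : unimodular_ends (2 * n).-1 (excess_poly k (RS b k) (RSrev b k)).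
  rewrite nE; have [H1 H2 H3 H4] := unimodular_ends_rs k.
  by apply: excess_poly_ends => //; case: b.
case: ends => sz e0 el.
have H1 : 1 <= normc (excess_poly k (RS b k) (RSrev b k)).[0] *
   normc (lead_coef (excess_poly k (RS b k) (RSrev b k))) by rewrite e0 el mulr1.
have M1 : 1 <= n%:R :> R by lra.
have HM t : `|excess b k t| <= n%:R by rewrite nE; exact: excess_bound.
have := zero_count_le (twist_excessE b k) H1 M1 HM d01 a0 ab b2.
move=> H; apply: (le_trans H); rewrite lee_fin sz -/L -/s.
have N2 : ((2 * n).-1.-1)%:R <= 2 * n%:R :> R.
  by rewrite -natrM ler_nat (leq_trans (leq_pred _))// leq_pred.
have t1 : ((2 * n).-1.-1)%:R * (be - al) / (2 * pi) <= n%:R * (be - al) / pi.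
  have -> : n%:R * (be - al) / pi = 2 * n%:R * (be - al) / (2 * pi).
    by move: (lt0r_neq0 p0); move: (pi : R) => q qn; field.
  by rewrite ler_pM2r ?invr_gt0 ?mulr_gt0// ler_wpM2r// subr_ge0.
have t2 : ((2 * n).-1.-1)%:R * d <= 4 / pi * s.
  apply: (@le_trans _ _ (2 * n%:R * d)); first by rewrite ler_wpM2r// ltW.
  rewrite /d le_eqVlt; apply/orP; left; apply/eqP.
  by move: (lt0r_neq0 p0) (lt0r_neq0 n0); move: (pi : R) n%:R => q m qn mn; field; rewrite qn mn.
have t3 : 16 * L / (pi ^+ 2 * d) = 4 / pi * s.
  have -> : L = s ^+ 2 / (2 * n%:R) by rewrite ss mulrC mulrA mulVf ?mul1r// mulf_neq0// gt_eqF.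
  rewrite /d; move: (lt0r_neq0 p0) (lt0r_neq0 n0) (lt0r_neq0 s0).
  clearbody s; by move: (pi : R) (n%:R : R) => q m qn mn sn; field; rewrite qn mn sn.
rewrite t3; lra.
Qed.
End RudinShapiroZeros.

(** * Rudin-Shapiro polynomials: the lower bound *)

Section SignChanges.
Local Open Scope complex_scope.
Variable R : realType.
Implicit Types (s t x r d w : R) (f h : R -> R).

Lemma zero_mult_ge0 f t : (0 <= zero_mult f t)%E.
Proof. by apply: le_ereal_inf_tmp => _ [m _ <-]; rewrite lee_fin. Qed.

Lemma zero_mult_ge1 f t : f t = 0 -> (1%:E <= zero_mult f t)%E.
Proof.
move=> ft; apply: le_ereal_inf_tmp => _ [m /= hm <-]; rewrite lee_fin.
case: m hm => [|m _]; first by rewrite derive1n0 ft eqxx.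
by rewrite ler1n.
Qed.

Lemma zero_count_ge0 (I : set R) f : (0 <= zero_count I f)%E.
Proof. by apply: esum_ge0 => t _; exact: zero_mult_ge0. Qed.

Lemma zero_count_ge_size (I : set R) f (ys : seq R) : uniq ys ->
  (forall y, y \in ys -> I y /\ f y = 0) -> ((size ys)%:R%:E <= zero_count I f)%E.
Proof.
move=> uys Hys; apply: esum_ge; exists [set` ys].
  by split; [exact: finite_seq | move=> y /= /Hys []].
rewrite -fsbig_seq//.
have -> : (size ys)%:R%:E = (\sum_(y <- ys) 1%:E)%E :> \bar R.
  by rewrite sumEFin big_const_seq count_predT iter_addr_0.
rewrite [leLHS]big_seq [leRHS]big_seq; apply: lee_sum => y /Hys [_ fy].
exact: zero_mult_ge1.
Qed.

(** One zero is chosen for each index; the last hypothesis keeps the chosen zeros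
    distinct. *)
Lemma zero_count_ge_intervals (I : set R) f (js : seq nat) (P : nat -> R -> Prop) :
  uniq js -> (forall j, j \in js -> exists y, [/\ P j y, I y & f y = 0]) ->
  (forall i j x y, i \in js -> j \in js -> (i < j)%N -> P i x -> P j y -> x < y) ->
  ((size js)%:R%:E <= zero_count I f)%E.
Proof.
move=> ujs Hjs Hlt.
have [g Hg] : exists g : nat -> R, forall j, j \in js -> [/\ P j (g j), I (g j) & f (g j) = 0].
  have : forall j, exists y, j \in js -> [/\ P j y, I y & f y = 0].
    move=> j; have [/Hjs [y Hy]|nj] := boolP (j \in js); first by exists y.
    by exists 0.
  by move=> /choice [g Hg]; exists g.
rewrite -(size_map g); apply: zero_count_ge_size.
  rewrite map_inj_in_uniq// => i j hi hj gij.
  have [Pi _ _] := Hg _ hi; have [Pj _ _] := Hg _ hj.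
  have [ij|ji|//] := ltngtP i j.
    by have := Hlt _ _ _ _ hi hj ij Pi Pj; rewrite gij ltxx.
  by have := Hlt _ _ _ _ hj hi ji Pj Pi; rewrite gij ltxx.
by move=> y /mapP [j /Hg [_ h1 h2] ->].
Qed.

Lemma zero_of_sign_change f x y : x <= y -> continuous f -> f x * f y <= 0 ->
  exists2 c, x <= c <= y & f c = 0.
Proof.
move=> xy cf fxy.
have cf' : {within `[x, y], continuous f} by apply: continuous_subspaceT.
have [|c] := @IVT R f x y 0 xy cf'; last first.
  by rewrite in_itv /= => cxy fc; exists c.
rewrite ge_min le_max; apply/andP; split; apply/orP.
  by case: (leP (f x) 0) => hx; [left | right; rewrite -(pmulr_rle0 _ hx)].
by case: (leP 0 (f x)) => hx; [left | right; rewrite -(nmulr_rle0 _ hx)].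
Qed.

(** If f has no zero in a closed interval between consecutive nodes, then f keeps
    its sign there, so h changes sign and vanishes in the open interval.  Open
    intervals are disjoint, so at most C of them contain zeros of h.  For the
    remaining indices, intervals whose indices have the same parity are disjoint,
    so each parity class is bounded by the number of zeros of f; whence the
    factor 1/2. *)
Lemma zero_count_lower_alternating f h (sg dl a b C : R) :
  continuous f -> continuous h -> sg != 0 -> 0 < dl -> 0 <= a -> a <= b ->
  (forall j : nat, f (j%:R * dl) = sg * (-1) ^+ j * h (j%:R * dl)) ->
  (zero_count `[a, b]%classic h <= C%:E)%E ->
  ((((b - a) / dl - 2 - C) / 2)%:E <= zero_count `[a, b]%classic f)%E.
Proof.
move=> cf ch sg0 dl0 a0 ab Hfh HC.
have C0 : 0 <= C by rewrite -lee_fin (le_trans (zero_count_ge0 `[a, b]%classic h)).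
(* the nodes of index j0, ..., j1 lie in [a, b]; j1 - j0 may fall short of
   (b - a) / dl by 2 *)
pose j0 := (Num.truncn (a / dl)).+1; pose j1 := Num.truncn (b / dl).
have adl : 0 <= a / dl by rewrite divr_ge0// ltW.
have bdl : 0 <= b / dl by apply: divr_ge0; [exact: le_trans a0 ab | exact: ltW].
have [ha1 ha2] : a <= j0%:R * dl /\ j0%:R - 1 <= a / dl.
  have /andP[h1 h2] := truncn_itv adl.
  by rewrite -ler_pdivrMr// ltW//= /j0 -natr1 addrK.
have [hb1 hb2] : j1%:R * dl <= b /\ b / dl <= j1%:R + 1.
  have /andP[h1 h2] := truncn_itv bdl.
  by rewrite -ler_pdivlMr// natr1 (ltW h2).
have [j01|j10] := leqP j0 j1; last first.
  apply: le_trans (zero_count_ge0 _ _); rewrite lee_fin ler_pdivrMr// mul0r.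
  have : j1%:R + 1 <= j0%:R :> R by rewrite natr1 ler_nat.
  by rewrite mulrBl; lra.
pose tj (j : nat) : R := j%:R * dl.
have tj_mono i j : (i <= j)%N -> tj i <= tj j by move=> ij; rewrite /tj ler_pM2r// ler_nat.
pose J := index_iota j0 j1.
have inJ j : j \in J -> a <= tj j /\ tj j.+1 <= b.
  rewrite mem_index_iota => /andP[h1 h2]; split.
    by apply: le_trans ha1 _; exact: tj_mono.
  by apply: le_trans hb1; exact: tj_mono.
pose A j := `[< exists2 x, tj j < x < tj j.+1 & h x = 0 >].
have notA j : ~~ A j -> exists2 y, tj j <= y <= tj j.+1 & f y = 0.
  move=> /asboolPn nA.
  apply: zero_of_sign_change => //; first exact: tj_mono.
  rewrite leNgt; apply/negP => fpos; apply: nA.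
  have hneg : h (tj j) * h (tj j.+1) < 0.
    move: fpos; rewrite /tj !Hfh exprS.
    have -> : sg * (-1) ^+ j * h (j%:R * dl) * (sg * (-1 * (-1) ^+ j) * h (j.+1%:R * dl)) =
      - (sg ^+ 2 * ((-1) ^+ j) ^+ 2 * (h (j%:R * dl) * h (j.+1%:R * dl))) by ring.
    rewrite sqrr_sign mulr1 oppr_gt0 pmulr_rlt0//.
    by rewrite exprn_even_gt0.
  have [x /andP[x1 x2] hx] := zero_of_sign_change (tj_mono _ _ (leqnSn j)) ch (ltW hneg).
  exists x => //; rewrite !lt_neqAle x1 x2 !andbT; apply/andP; split; apply/eqP => e.
    by move: hneg; rewrite e hx mul0r ltxx.
  by move: hneg; rewrite -e hx mulr0 ltxx.
have uJ : uniq J by exact: iota_uniq.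
have NA : ((count A J)%:R : R) <= C.
  rewrite -lee_fin; apply: le_trans HC; rewrite -size_filter.
  apply: (@zero_count_ge_intervals _ _ _ (fun j x => tj j < x < tj j.+1)).
  - exact: filter_uniq.
  - move=> j; rewrite mem_filter => /andP[/asboolP [x /andP[x1 x2] hx] /inJ [i1 i2]].
    exists x; split => //=; first by rewrite x1.
    by rewrite in_itv /= (le_trans i1 (ltW x1)) (le_trans (ltW x2) i2).
  - move=> i j x y _ _ ij /andP[_ x2] /andP[y1 _].
    by apply: (lt_trans x2); apply: le_lt_trans y1; exact: tj_mono.
have NB (e : bool) : ((count (fun j => ~~ A j && (odd j == e)) J)%:R%:E <=
    zero_count `[a, b]%classic f)%E.
  rewrite -size_filter.
  apply: (@zero_count_ge_intervals _ _ _ (fun j x => tj j <= x <= tj j.+1)).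
  - exact: filter_uniq.
  - move=> j; rewrite mem_filter /= => /andP[/andP[nA _] /inJ [i1 i2]].
    have [y /andP[y1 y2] fy] := notA _ nA.
    exists y; split => //=; first by rewrite y1.
    by rewrite in_itv /= (le_trans i1 y1) (le_trans y2 i2).
  - move=> i j x y; rewrite !mem_filter /= => /andP[/andP[_ /eqP oi] _] /andP[/andP[_ /eqP oj] _].
    move=> ij /andP[_ x2] /andP[y1 _].
    apply: (le_lt_trans x2); apply: lt_le_trans y1; rewrite /tj ltr_pM2r// ltr_nat.
    rewrite ltn_neqAle ij andbT; apply/eqP => e'.
    by move: oj; rewrite -e' /= oi => /eqP; case: (e).
have [//|Nfin] := eqVneq (zero_count `[a, b]%classic f) +oo%E; first by move=> ->; rewrite leey.
have Nf0 := zero_count_ge0 `[a, b]%classic f.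
move: Nfin Nf0 NB; case: (zero_count _ _) => [N _ N0 NB|//|//].
have N1 := NB true; have N2 := NB false; rewrite !lee_fin in N1 N2 *.
have tot : (count A J + (count (fun j => ~~ A j && (odd j == true)) J +
   count (fun j => ~~ A j && (odd j == false)) J) = j1 - j0)%N.
  rewrite -[RHS](size_iota j0) -/(index_iota j0 j1) -/J -(count_predC A J); congr addn.
  elim: (J) => //= j s IH; rewrite addnACA IH; congr addn.
  by case: (A j) => //=; case: (odd j).
have totR : (count A J)%:R + ((count (fun j => ~~ A j && (odd j == true)) J)%:R +
   (count (fun j => ~~ A j && (odd j == false)) J)%:R) = j1%:R - j0%:R :> R.
  by rewrite -!natrD tot natrB.
rewrite ler_pdivrMr//.
have : (b - a) / dl - 2 <= j1%:R - j0%:R by rewrite mulrBl; lra.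
lra.
Qed.

(** At such a point z^(2^(k+1)) = (-1)^j, so P_(k+2) is either the sum or the
    difference of P_(k+1) and Q_(k+1), that is 2 P_k or 2 z^(2^k) Q_k; likewise
    for Q_(k+2).  As |P_k|^2 + |Q_k|^2 = 2^(k+1), the second case gives the
    opposite of the first one. *)
Lemma excess_nodes bb k (j : nat) :
  excess bb k.+2 (j%:R * (2 * pi / (2 ^ k.+2)%:R)) =
  (if bb then 4 else - 4) * (-1) ^+ j * excess true k (j%:R * (2 * pi / (2 ^ k.+2)%:R)) :> R.
Proof.
set t := _ * (_ / _).
have n0 : (2 ^ k)%:R != 0 :> R by rewrite pnatr_eq0 expn_eq0.
have z2 : expi t ^+ (2 ^ k.+1) = (-1) ^+ j :> R[i].
  rewrite expiX.
  have -> : (2 ^ k.+1)%:R * t = j%:R * pi by rewrite /t !expnS !natrM; field.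
  rewrite -expiX; congr (_ ^+ _); rewrite /expi cospi sinpi.
  by apply/eqP; rewrite eq_complex /= oppr0 !eqxx.
have S := sqmod_sum k t.
pose w := expi t ^+ (2 ^ k).
have nw : normc w = 1 by rewrite normcX normc_expi expr1n.
have n2 (u : R[i]) : normc (u + u) ^+ 2 = 4 * normc u ^+ 2.
  by rewrite !sqr_normc; case: u => x y /=; ring.
have e1 : (RSP R k + 'X^(2 ^ k) * RSQ R k).[expi t] +
   (RSP R k - 'X^(2 ^ k) * RSQ R k).[expi t] = (RSP R k).[expi t] + (RSP R k).[expi t].
  by rewrite !hornerD hornerN; ring.
have e2 : (RSP R k + 'X^(2 ^ k) * RSQ R k).[expi t] -
   (RSP R k - 'X^(2 ^ k) * RSQ R k).[expi t] =
   w * (RSQ R k).[expi t] + w * (RSQ R k).[expi t].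
  by rewrite !hornerD hornerN !hornerM hornerXn -/w; ring.
have nn : (2 ^ k.+2)%:R = 4 * (2 ^ k)%:R :> R by rewrite !expnS !natrM; ring.
rewrite /excess /sqmod_circle /= nn.
have -> : (RS R bb k.+2).[expi t] =
   if bb then (RSP R k.+1).[expi t] + (-1) ^+ j * (RSQ R k.+1).[expi t]
   else (RSP R k.+1).[expi t] - (-1) ^+ j * (RSQ R k.+1).[expi t].
  by case: bb; rewrite /= ?(RSPS R k.+1) ?(RSQS R k.+1) !hornerD ?hornerN hornerM hornerXn z2.
rewrite RSPS RSQS -(@signr_odd R j) -(@signr_odd R[i] j).
case: (odd j) => /=; case: bb; rewrite ?expr0 ?expr1 ?mul1r ?mulN1r ?opprK ?e1 ?e2;
  by rewrite n2 ?ComplexField.Normc.normcM ?nw ?mul1r; lra.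
Qed.

Lemma continuous_excess bb k : continuous (@excess R bb k).
Proof.
have -> : @excess R bb k =
   fun t => complex.Re (twist (2 ^ k).-1 (excess_poly k (RS R bb k) (RSrev R bb k)) t).
  by apply/funext => t; rewrite twist_excessE.
move=> t; apply/differentiable_continuous/derivable1_diffP.
by case: (is_derive_Re_twist (2 ^ k).-1 (excess_poly k (RS R bb k) (RSrev R bb k)) t).
Qed.

(** [zero_count_lower_alternating] with the upper bound for k - 2.  For k = 2 the
    comparison function is identically zero, but the claimed bound is not
    positive. *)
Theorem excess_zero_count_ge bb k (n : nat) (al be : R) : (2 <= k)%N -> n = (2 ^ k)%N ->
  0 <= al -> al <= be -> be < 2 * pi ->
  ((n%:R * (be - al) / (8 * pi) - 2 / pi * Num.sqrt (2 * n%:R * ln n%:R) - 1)%:E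
   <= zero_count `[al, be]%classic (@excess R bb k))%E.
Proof.
move=> k2 nE a0 ab b2; have p0 := @pi_gt0 R; have pn := lt0r_neq0 p0.
(* n = 4 and be - al <= 2 pi, so the main term is at most 1 *)
have [kle|k3] := leqP k 2.
  apply: le_trans (zero_count_ge0 _ _); rewrite lee_fin.
  have -> : n%:R = 4 :> R by rewrite nE (anti_leq (introT andP (conj kle k2))).
  have : 0 <= 2 / pi * Num.sqrt (2 * 4 * ln 4) :> R.
    by rewrite mulr_ge0 ?sqrtr_ge0// divr_ge0// ltW.
  have : 4 * (be - al) / (8 * pi) <= 1.
    by rewrite ler_pdivrMr ?mulr_gt0//; lra.
  lra.
case: k k2 nE k3 => [//|[//|k]] _ nE k3.
pose m := (2 ^ k)%N.
have nm : n%:R = 4 * m%:R :> R by rewrite nE /m !expnS !natrM; ring.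
have m1 : 1 <= m%:R :> R by rewrite ler1n expn_gt0.
have up := @excess_zero_count_le R true k m al be k3 erefl a0 ab b2.
have n0 : 0 < n%:R :> R by rewrite nm; lra.
have sg0 : (if bb then 4 else - 4 : R) != 0 by case: bb; rewrite ?oppr_eq0 pnatr_eq0.
have dl0 : 0 < 2 * pi / (2 ^ k.+2)%:R :> R by rewrite divr_gt0 ?mulr_gt0// -nE.
have := zero_count_lower_alternating (@continuous_excess bb k.+2)
  (@continuous_excess true k) sg0 dl0 a0 ab (excess_nodes bb k) up.
apply: le_trans; rewrite lee_fin -nE.
have e1 : (be - al) / (2 * pi / n%:R) = 4 * (n%:R * (be - al) / (8 * pi)).
  by move: (lt0r_neq0 n0) pn; move: (pi : R) n%:R => q x xn qn; field; rewrite qn xn.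
have e2 : m%:R * (be - al) / pi = 2 * (n%:R * (be - al) / (8 * pi)).
  by rewrite nm; move: pn; move: (pi : R) => q qn; field.
have e3 : 8 / pi * Num.sqrt (2 * m%:R * ln m%:R) <= 4 / pi * Num.sqrt (2 * n%:R * ln n%:R) :> R.
  have -> : 8 / pi * Num.sqrt (2 * m%:R * ln m%:R) =
    4 / pi * (2 * Num.sqrt (2 * m%:R * ln m%:R)) :> R by ring.
  rewrite ler_wpM2l ?divr_ge0 ?(ltW p0)//.
  have sq2 (x : R) : 2 * Num.sqrt x = Num.sqrt (2 ^+ 2 * x).
    by rewrite sqrtrM ?sqr_ge0// sqrtr_sqr ger0_norm.
  rewrite sq2; apply: ler_wsqrtr.
  have -> : 2 ^+ 2 * (2 * m%:R * ln m%:R) = 2 * n%:R * ln m%:R :> R by rewrite nm; ring.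
  rewrite ler_wpM2l ?mulr_ge0 ?(ltW n0)// ler_ln ?posrE//; last by lra.
  by rewrite nm; lra.
have e4 (x : R) : 2 / pi * x = 4 / pi * x / 2 by move: (pi^-1 : R) => u; field.
rewrite e1 e2 e4; move: e3.
lra.
Qed.
End SignChanges.

Theorem theorem2p1 (R : realType) (k n : nat) (Rk : R -> R) (alpha beta : R)
    (hk : (2 <= k)%N) (hn : n = (2 ^ k)%N)
    (hRk : Rk = sqmod_circle (RSP R k) \/ Rk = sqmod_circle (RSQ R k))
    (h0 : 0 <= alpha) (hab : alpha <= beta) (hb : beta < 2 * pi) :
  ((n%:R * (beta - alpha) / (8 * pi)
      - 2 / pi * Num.sqrt (2 * n%:R * ln n%:R) - 1)%:E
    <= zero_count `[alpha, beta] (fun t => (Rk t - n%:R)%R)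
    <= (n%:R * (beta - alpha) / pi
      + 8 / pi * Num.sqrt (2 * n%:R * ln n%:R))%:E)%E.
Proof.
have [b ->] : exists b, (fun t => (Rk t - n%:R)%R) = excess b k.
  by case: hRk => ->; [exists true | exists false]; rewrite hn.
by rewrite excess_zero_count_ge// excess_zero_count_le// ltnW.
Qed.
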